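(* Let $(\sigma_n)_{n\ge1}$ be a sequence of positive real numbers converging to $0$ such that $\limsup_{n}\frac{\sigma_{n+1}}{\sigma_n}=1$. Then there exists a sequence $(s_n)_{n\ge1}$ in $\mathbb{C}_+$ with $\operatorname{Re}(s_n)=\sigma_n$ for every $n$ that is interpolating for $H^\infty(\mathbb{C}_+)$ but is not interpolating for $\mathscr{H}^{\infty}$.
   Context: $\mathbb{C}_+=\{s\in\mathbb{C}:\operatorname{Re}(s)>0\}$, and $H^\infty(\mathbb{C}_+)$ is the algebra of bounded analytic functions on $\mathbb{C}_+$. $\mathscr{H}^\infty$ is the algebra of all bounded analytic functions $f$ on $\mathbb{C}_+$ that can be represented by a Dirichlet series $f(s)=\sum_{n\ge1}a_n n^{-s}$ (convergent in some half-plane). For either algebra $A$, a sequence $(s_n)_n$ in $\mathbb{C}_+$ is interpolating for $A$ if for every bounded complex sequence $(\alpha_n)_n$ there is $f\in A$ with $f(s_n)=\alpha_n$ for every $n$. *)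

(* Defs.v *)
From Stdlib Require Import Reals.
From Coquelicot Require Import Coquelicot.
Open Scope R_scope.

(** A function on the right half-plane [C_+] is represented by a total function
    [C -> C]; every condition below constrains its values on [C_+] only.
    Sequences indexed by n >= 1 are indexed here by [nat], index [n] standing
    for n + 1. *)

Definition right_half_plane (s : C) : Prop := 0 < Re s.

(** Complex differentiability at every point; [C] is both the scalar field and
    the target space. *)
Definition analytic_on_rhp (f : C -> C) : Prop :=
  forall s : C, right_half_plane s -> @ex_derive C_AbsRing C_NormedModule f s.

Definition bounded_on_rhp (f : C -> C) : Prop :=
  exists M : R, forall s : C, right_half_plane s -> Cmod (f s) <= M.

Definition Hinfty (f : C -> C) : Prop := analytic_on_rhp f /\ bounded_on_rhp f.

Definition Cexp (z : C) : C := (exp (Re z) * cos (Im z), exp (Re z) * sin (Im z)).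

(** n^(-s) = exp (- s ln n), meaningful for n >= 1. *)
Definition nat_cpow_opp (n : nat) (s : C) : C :=
  Cexp (Copp (Cmult s (RtoC (ln (INR n))))).

(** The series sum_{n >= 1} a_n n^(-s) converges, with sum [f s], on some
    half-plane Re s > theta. As [f] is only meaningful on [C_+], the half-plane
    is taken inside [C_+]; this loses nothing, as a larger half-plane of
    convergence can be shrunk. *)
Definition represented_by_dirichlet_series (f : C -> C) : Prop :=
  exists (a : nat -> C) (theta : R), 0 <= theta /\
    forall s : C, theta < Re s ->
      @is_series C_AbsRing C_NormedModule
        (fun n : nat => Cmult (a n) (nat_cpow_opp (S n) s)) (f s).

Definition dirichlet_Hinfty (f : C -> C) : Prop :=
  Hinfty f /\ represented_by_dirichlet_series f.

Definition interpolating (A : (C -> C) -> Prop) (s : nat -> C) : Prop :=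
  forall alpha : nat -> C,
    (exists M : R, forall n : nat, Cmod (alpha n) <= M) ->
    exists f : C -> C, A f /\ forall n : nat, f (s n) = alpha n.

(* Main.v *)
Require Import Defs.
From Stdlib Require Import Reals Arith Lra Lia Classical IndefiniteDescription.
From Coquelicot Require Import Coquelicot.
Open Scope R_scope.

(** Put [s_n = sigma_n + i t_n] with [t_(n+1) = t_n + tau_n].  If the [tau_n] grow fast enough, the
    kernels [2 sigma_n / (s + conj s_n)] form an almost diagonal interpolation matrix at the points
    [s_m], and a Neumann series gives interpolation by [H^infty] functions.

    Choose moreover [tau_n] to be a common almost period of the functions [k^(-i t)].  If [f] is in
    the Dirichlet algebra, then [f (s + i tau_n) - f s] is tiny far to the right, where the Dirichlet
    series converges absolutely, and bounded on [C_+]; by a two-constant theorem it is still small on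
    the line [Re s = sigma_n], provided that [tau_n] was chosen well with respect to [sigma_n].  By the
    Schwarz lemma, [f] varies little between the abscissae [sigma_n] and [sigma_(n+1)] whenever their
    ratio is close to 1.  Hence [f s_(n+1) - f s_n] is small for infinitely many [n], and [f] cannot
    take the values 1 and 0 alternately.

    The maximum principle behind the last two estimates is only needed up to a constant; it comes from
    Goursat's theorem for [(G - G x0)^2 / (z - x0)], which is differentiable everywhere. *)

(** * Complex differentiability *)

(** Coquelicot's product and composition rules are stated for this target, whose uniform structure
    is not convertible to that of [C_NormedModule]. *)
Notation Cderivable f z := (@ex_derive C_AbsRing (AbsRing_NormedModule C_AbsRing) f z).

Lemma is_derive_C_eps (f : C -> C) (z l : C) :
  @is_derive C_AbsRing C_NormedModule f z l <->
  forall eps, 0 < eps -> exists d, 0 < d /\ forall w : C, Cmod (w - z) < d ->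
    Cmod (f w - f z - l * (w - z)) <= eps * Cmod (w - z).
Proof.
  split.
  - intros [_ H] eps Heps.
    destruct (H z (fun P HP => HP) (mkposreal eps Heps)) as [d Hd].
    exists d; split; [apply cond_pos|]. intros w Hw.
    specialize (Hd w Hw).
    replace (l * (w - z))%C with ((w-z)*l)%C by ring. exact Hd.
  - intros H. split.
    + apply (is_linear_scal_l (V:=C_NormedModule) l).
    + intros x Hx eps.
      apply (is_filter_lim_locally_unique (V:=AbsRing_NormedModule C_AbsRing) z x) in Hx. subst x.
      destruct (H eps (cond_pos eps)) as [d [Hd Hw]].
      exists (mkposreal d Hd). intros w Hb. specialize (Hw w Hb).
    replace (l * (w - z))%C with ((w-z)*l)%C in Hw by ring. exact Hw.
Qed.

Lemma is_derive_C_target (f : C -> C) (z l : C) :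
  @is_derive C_AbsRing C_NormedModule f z l <->
  @is_derive C_AbsRing (AbsRing_NormedModule C_AbsRing) f z l.
Proof.
  split; intros [_ H]; (split; [|exact H]).
  - apply (is_linear_scal_l (V:=AbsRing_NormedModule C_AbsRing) l).
  - apply (is_linear_scal_l (V:=C_NormedModule) l).
Qed.

Lemma ex_derive_C_target (f : C -> C) (z : C) :
  @ex_derive C_AbsRing C_NormedModule f z <-> Cderivable f z.
Proof. split; intros [l H]; exists l; apply is_derive_C_target, H. Qed.

Lemma Cderivable_mult (f g : C -> C) (z : C) :
  Cderivable f z -> Cderivable g z -> Cderivable (fun w => f w * g w)%C z.
Proof.
  intros [l Hl] [m Hm]. eexists.
  apply (is_derive_mult (K:=C_AbsRing) f g z l m Hl Hm). intros; apply Cmult_comm.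
Qed.

Lemma Cderivable_pow (f : C -> C) (z : C) (n : nat) :
  Cderivable f z -> Cderivable (fun w => f w ^ n)%C z.
Proof.
  intros H. induction n; simpl.
  - apply (ex_derive_const (V:=AbsRing_NormedModule C_AbsRing)).
  - apply Cderivable_mult; assumption.
Qed.

Lemma Cmod_minus_sym (z w : C) : Cmod (z - w) = Cmod (w - z).
Proof. rewrite <- Cmod_opp. f_equal. ring. Qed.

Lemma Cmod_minus_ge (z w : C) : Cmod z - Cmod w <= Cmod (z - w).
Proof. generalize (Cmod_triangle (z - w) w). replace (z - w + w)%C with z by ring. lra. Qed.

Lemma Cderivable_inv_id (z : C) : z <> 0 -> Cderivable (fun w => / w)%C z.
Proof.
  intros Hz. exists (- / (z * z))%C. apply is_derive_C_target, is_derive_C_eps.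
  intros eps Heps. assert (Hm : 0 < Cmod z) by (apply Cmod_gt_0; assumption).
  pose (m := Cmod z).
  exists (Rmin (m / 2) (eps * m ^ 3 / 2)). split.
  { apply Rmin_pos. unfold m; lra.
    assert (0 < m ^ 3) by (apply pow_lt; exact Hm). nra. }
  intros w Hw.
  assert (H1 : Cmod (w - z) < m / 2) by (eapply Rlt_le_trans; [exact Hw|apply Rmin_l]).
  assert (H2 : Cmod (w - z) < eps * m ^ 3 / 2) by (eapply Rlt_le_trans; [exact Hw|apply Rmin_r]).
  assert (H3 : m / 2 < Cmod w).
  { generalize (Cmod_minus_ge z w). rewrite Cmod_minus_sym. unfold m in *; lra. }
  assert (Hw0 : w <> 0) by (apply Cmod_gt_0; unfold m in *; lra).
  replace (/ w - / z - - / (z * z) * (w - z))%C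
    with ((w - z) * ((w - z) / (w * (z * z))))%C by (field; auto).
  rewrite Cmod_mult, Rmult_comm. apply Rmult_le_compat_r; [apply Cmod_ge_0|].
  assert (Hzz : (w * (z * z) <> 0)%C) by (repeat apply Cmult_neq_0; auto).
  rewrite Cmod_div, !Cmod_mult by auto. fold m.
  assert (0 < m * m) by (apply Rmult_lt_0_compat; exact Hm).
  apply Rle_div_l.
  { apply Rmult_lt_0_compat; [|assumption]. unfold m in *; lra. }
  apply Rle_trans with (eps * (m / 2 * (m * m))). lra.
  apply Rmult_le_compat_l; [lra|]. apply Rmult_le_compat_r; lra.
Qed.

Lemma Cderivable_inv (f : C -> C) (z : C) :
  Cderivable f z -> f z <> 0 -> Cderivable (fun w => / f w)%C z.
Proof.
  intros H Hz.
  apply (ex_derive_comp (K:=C_AbsRing) (V:=AbsRing_NormedModule C_AbsRing) Cinv f z);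
  [apply Cderivable_inv_id|]; assumption.
Qed.

Lemma Cderivable_const (c z : C) : Cderivable (fun _ => c) z.
Proof. apply (ex_derive_const (V:=AbsRing_NormedModule C_AbsRing)). Qed.

Lemma Cderivable_id (z : C) : Cderivable (fun w => w) z.
Proof. apply (ex_derive_id (K:=C_AbsRing)). Qed.

Lemma Cderivable_plus (f g : C -> C) (z : C) :
  Cderivable f z -> Cderivable g z -> Cderivable (fun w => f w + g w)%C z.
Proof. apply (ex_derive_plus (V:=AbsRing_NormedModule C_AbsRing)). Qed.

Lemma Cderivable_minus (f g : C -> C) (z : C) :
  Cderivable f z -> Cderivable g z -> Cderivable (fun w => f w - g w)%C z.
Proof. apply (ex_derive_minus (V:=AbsRing_NormedModule C_AbsRing)). Qed.

Lemma Cderivable_affine (f : C -> C) (a b z : C) :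
  Cderivable f (a * z + b)%C -> Cderivable (fun w => f (a * w + b)%C) z.
Proof.
  intros H.
  apply (ex_derive_comp (K:=C_AbsRing) (V:=AbsRing_NormedModule C_AbsRing) f (fun w => a * w + b)%C z);
  [assumption|].
  apply Cderivable_plus; [apply Cderivable_mult|];
  auto using Cderivable_const, Cderivable_id.
Qed.

(** Multiplying the difference quotient by a second factor [f w - f a] makes the singularity at
    [a] removable without knowing that [f'] is continuous. *)
Lemma Cderivable_sqr_quotient (f : C -> C) (a z : C) :
  Cderivable f z -> Cderivable (fun w => (f w - f a) * (f w - f a) / (w - a))%C z.
Proof.
  intros H. destruct (Ceq_dec z a) as [->|Hza].
  - destruct H as [l Hl]. exists (l * l)%C.
    apply is_derive_C_target, is_derive_C_eps.
    apply is_derive_C_target in Hl. rewrite is_derive_C_eps in Hl.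
    intros eps Heps.
    pose (K := 2 * Cmod l + 1). assert (HK : 0 < K) by (unfold K; generalize (Cmod_ge_0 l); lra).
    destruct (Hl (Rmin 1 (eps / K))) as [d [Hd Hw]].
    { apply Rmin_pos; [lra|]. apply Rdiv_lt_0_compat; assumption. }
    exists d. split; [assumption|]. intros w Hwd.
    specialize (Hw w Hwd).
    destruct (Ceq_dec w a) as [->|Hwa].
    { match goal with |- Cmod ?x <= _ => replace x with (RtoC 0) end.
      rewrite Cmod_0. apply Rmult_le_pos; [lra|apply Cmod_ge_0].
      unfold Cdiv. ring_simplify. reflexivity. }
    assert (Hne : (w - a <> 0)%C).
    { intros E. apply Hwa. replace w with ((w - a) + a)%C by ring. rewrite E. ring. }
    pose (q := ((f w - f a) / (w - a) - l)%C).
    assert (Hq : Cmod q <= Rmin 1 (eps / K)).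
    { assert (Hp : 0 < Cmod (w - a)) by (apply Cmod_gt_0; assumption).
      replace q with ((f w - f a - l * (w - a)) / (w - a))%C by (unfold q; field; auto).
      rewrite Cmod_div by assumption. apply Rle_div_l; assumption. }
    assert (Hq1 := Rle_trans _ _ _ Hq (Rmin_l _ _)).
    assert (Hq2 := Rle_trans _ _ _ Hq (Rmin_r _ _)).
    replace ((f w - f a) * (f w - f a) / (w - a) - (f a - f a) * (f a - f a) / (a - a) - l * l * (w - a))%C
      with (q * (q + 2 * l) * (w - a))%C.
    2:{ unfold q. replace ((f a - f a) * (f a - f a) / (a - a))%C with (RtoC 0).
        field; auto. unfold Cdiv. ring. }
    rewrite Cmod_mult. apply Rmult_le_compat_r; [apply Cmod_ge_0|].
    rewrite Cmod_mult.
    assert (Cmod (q + 2 * l) <= K).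
    { eapply Rle_trans; [apply Cmod_triangle|]. rewrite Cmod_mult, Cmod_R.
      unfold K. rewrite Rabs_pos_eq; lra. }
    apply Rle_trans with (eps / K * K).
    apply Rmult_le_compat; auto using Cmod_ge_0.
    right. field. lra.
  - assert (Hne : (z - a <> 0)%C).
    { intros E. apply Hza. replace z with ((z - a) + a)%C by ring. rewrite E. ring. }
    unfold Cdiv.
    assert (Cderivable (fun w => f w - f a)%C z)
      by (apply Cderivable_minus; auto using Cderivable_const).
    apply Cderivable_mult; [apply Cderivable_mult; assumption|].
    apply (Cderivable_inv (fun w => w - a)%C); [|assumption].
    apply Cderivable_minus; auto using Cderivable_const, Cderivable_id.
Qed.

(** * Goursat's theorem on rectangles *)

Lemma Cderivable_eps (f : C -> C) (z : C) : Cderivable f z ->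
  exists l : C, forall eps, 0 < eps -> exists d, 0 < d /\ forall w : C, Cmod (w - z) < d ->
    Cmod (f w - f z - l * (w - z)) <= eps * Cmod (w - z).
Proof.
  intros [l Hl]. exists l. apply is_derive_C_eps, is_derive_C_target, Hl.
Qed.

Lemma Cderivable_continuous_eps (f : C -> C) (z : C) : Cderivable f z ->
  forall eps, 0 < eps -> exists d, 0 < d /\ forall w : C, Cmod (w - z) < d ->
    Cmod (f w - f z) < eps.
Proof.
  intros H eps Heps. destruct (Cderivable_eps _ _ H) as [l Hl].
  destruct (Hl 1 Rlt_0_1) as [d [Hd Hw]].
  pose (K := Cmod l + 1). assert (HK : 0 < K) by (unfold K; generalize (Cmod_ge_0 l); lra).
  exists (Rmin d (eps / K)). split.
  { apply Rmin_pos; [assumption|]. apply Rdiv_lt_0_compat; assumption. }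
  intros w Hwd.
  assert (H1 := Rlt_le_trans _ _ _ Hwd (Rmin_l _ _)).
  assert (H2 := Rlt_le_trans _ _ _ Hwd (Rmin_r _ _)).
  apply Rlt_div_r in H2; [|assumption].
  specialize (Hw w H1).
  generalize (Cmod_triangle (f w - f z - l * (w - z)) (l * (w - z))).
  rewrite Cmod_mult.
  replace (f w - f z - l * (w - z) + l * (w - z))%C with (f w - f z)%C by ring.
  unfold K in H2. lra.
Qed.

Lemma im_le_Cmod (z : C) : Rabs (Im z) <= Cmod z.
Proof. generalize (Rmax_Cmod z) (Rmax_r (Rabs (fst z)) (Rabs (snd z))). unfold Im. lra. Qed.

Lemma Cmod_le_Rabs (z : C) : Cmod z <= Rabs (Re z) + Rabs (Im z).
Proof.
  destruct z as [x y]. simpl.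
  replace ((x, y) : C) with (RtoC x + Ci * RtoC y)%C.
  2:{ unfold RtoC, Ci, Cplus, Cmult; simpl. f_equal; ring. }
  eapply Rle_trans; [apply Cmod_triangle|].
  rewrite Cmod_mult, Cmod_Ci, !Cmod_R. lra.
Qed.

Lemma continuous_Re_path (F : C -> C) (g : R -> C) (t : R) :
  (forall s, Cmod (g s - g t) <= Rabs (s - t)) -> Cderivable F (g t) ->
  continuous (fun s => Re (F (g s))) t /\ continuous (fun s => Im (F (g s))) t.
Proof.
  intros Hg HF. split; apply filterlim_locally; intros eps;
  destruct (Cderivable_continuous_eps F (g t) HF eps (cond_pos eps)) as [d [Hd Hw]];
  exists (mkposreal d Hd); intros s Hs.
  - change (Rabs (Re (F (g s)) - Re (F (g t))) < eps).
    eapply Rle_lt_trans; [|apply (Hw (g s))].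
    + exact (re_le_Cmod (F (g s) - F (g t))%C).
    + eapply Rle_lt_trans; [apply Hg|exact Hs].
  - change (Rabs (Im (F (g s)) - Im (F (g t))) < eps).
    eapply Rle_lt_trans; [|apply (Hw (g s))].
    + exact (im_le_Cmod (F (g s) - F (g t))%C).
    + eapply Rle_lt_trans; [apply Hg|exact Hs].
Qed.

Lemma Cmod_horizontal (x x' y : R) : Cmod ((x, y) - (x', y))%C <= Rabs (x - x').
Proof.
  eapply Rle_trans; [apply Cmod_le_Rabs|]. simpl.
  replace (y + - y) with 0 by ring. rewrite Rabs_R0. unfold Rminus. lra.
Qed.

Lemma Cmod_vertical (x y y' : R) : Cmod ((x, y) - (x, y'))%C <= Rabs (y - y').
Proof.
  eapply Rle_trans; [apply Cmod_le_Rabs|]. simpl.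
  replace (x + - x) with 0 by ring. rewrite Rabs_R0. unfold Rminus. lra.
Qed.

Definition Cderivable_on_rect (F : C -> C) (a b c d : R) : Prop :=
  forall x y, a <= x <= b -> c <= y <= d -> Cderivable F (x, y).

Lemma ex_RInt_horizontal (F : C -> C) (a b y : R) : a <= b ->
  (forall x, a <= x <= b -> Cderivable F (x, y)) ->
  ex_RInt (fun x => Re (F (x, y))) a b.
Proof.
  intros Hab H. apply (ex_RInt_continuous (V:=R_CompleteNormedModule)). intros x Hx.
  rewrite Rmin_left, Rmax_right in Hx by assumption.
  apply (continuous_Re_path F (fun x => (x, y))); auto.
  intros; apply Cmod_horizontal.
Qed.

Lemma ex_RInt_vertical (F : C -> C) (c d x : R) : c <= d ->
  (forall y, c <= y <= d -> Cderivable F (x, y)) ->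
  ex_RInt (fun y => Im (F (x, y))) c d.
Proof.
  intros Hab H. apply (ex_RInt_continuous (V:=R_CompleteNormedModule)). intros y Hy.
  rewrite Rmin_left, Rmax_right in Hy by assumption.
  apply (continuous_Re_path F (fun y => (x, y))); auto.
  intros; apply Cmod_vertical.
Qed.

(** Real part of the counterclockwise integral of [F] along the boundary of
    [[a, b] x [c, d]]. *)
Definition Re_rect_int (F : C -> C) (a b c d : R) : R :=
  RInt (fun x => Re (F (x, c))) a b - RInt (fun x => Re (F (x, d))) a b
  - RInt (fun y => Im (F (b, y))) c d + RInt (fun y => Im (F (a, y))) c d.

Lemma Re_rect_int_split_x (F : C -> C) (a m b c d : R) :
  a <= m <= b -> c <= d -> Cderivable_on_rect F a b c d ->
  Re_rect_int F a b c d = Re_rect_int F a m c d + Re_rect_int F m b c d.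
Proof.
  intros [H1 H2] Hcd HF. unfold Re_rect_int.
  rewrite <- (RInt_Chasles (fun x => Re (F (x, c))) a m b);
  [rewrite <- (RInt_Chasles (fun x => Re (F (x, d))) a m b)|..];
  try (apply ex_RInt_horizontal; [lra|intros; apply HF; lra]).
  unfold plus; simpl. ring.
Qed.

Lemma Re_rect_int_split_y (F : C -> C) (a b c m d : R) :
  a <= b -> c <= m <= d -> Cderivable_on_rect F a b c d ->
  Re_rect_int F a b c d = Re_rect_int F a b c m + Re_rect_int F a b m d.
Proof.
  intros Hab [H1 H2] HF. unfold Re_rect_int.
  rewrite <- (RInt_Chasles (fun y => Im (F (a, y))) c m d);
  [rewrite <- (RInt_Chasles (fun y => Im (F (b, y))) c m d)|..];
  try (apply ex_RInt_vertical; [lra|intros; apply HF; lra]).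
  unfold plus; simpl. ring.
Qed.

Lemma Re_rect_int_split4 (F : C -> C) (a m b c k d : R) :
  a <= m <= b -> c <= k <= d -> Cderivable_on_rect F a b c d ->
  Re_rect_int F a b c d = Re_rect_int F a m c k + Re_rect_int F m b c k
    + (Re_rect_int F a m k d + Re_rect_int F m b k d).
Proof.
  intros Hm Hk HF.
  rewrite (Re_rect_int_split_y F a b c k d) by (auto; lra).
  rewrite !(Re_rect_int_split_x F a m b); auto; try lra; intros x y Hx Hy; apply HF; lra.
Qed.

Lemma RInt_affine (p q a b : R) :
  RInt (fun x => p + q * x) a b = p * (b - a) + q * (b ^ 2 - a ^ 2) / 2.
Proof.
  apply (is_RInt_unique (V:=R_CompleteNormedModule)).
  replace (p * (b - a) + q * (b ^ 2 - a ^ 2) / 2) with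
    (minus ((fun x => p * x + q * x ^ 2 / 2) b) ((fun x => p * x + q * x ^ 2 / 2) a)).
  2:{ unfold minus, plus, opp; simpl. field. }
  apply (is_RInt_derive (V:=R_CompleteNormedModule) (fun x => p * x + q * x ^ 2 / 2)).
  - intros x _. auto_derive; auto. field.
  - intros x _. apply (ex_derive_continuous (K:=R_AbsRing) (V:=R_NormedModule)). auto_derive; auto.
Qed.

Lemma Re_rect_int_affine (p l : C) (a b c d : R) :
  Re_rect_int (fun z => p + l * z)%C a b c d = 0.
Proof.
  destruct p as [p1 p2], l as [l1 l2]. unfold Re_rect_int; simpl.
  assert (E1 : forall y, RInt (fun x => p1 + (l1 * x - l2 * y)) a b
    = (p1 - l2 * y) * (b - a) + l1 * (b ^ 2 - a ^ 2) / 2).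
  { intros y. rewrite <- RInt_affine. apply RInt_ext. intros.
    lazymatch goal with |- @eq _ ?u ?v => change (@eq R u v) end. ring. }
  assert (E2 : forall x, RInt (fun y => p2 + (l1 * y + l2 * x)) c d
    = (p2 + l2 * x) * (d - c) + l1 * (d ^ 2 - c ^ 2) / 2).
  { intros x. rewrite <- RInt_affine. apply RInt_ext. intros.
    lazymatch goal with |- @eq _ ?u ?v => change (@eq R u v) end. ring. }
  rewrite !E1, !E2. field.
Qed.

Lemma RInt_dist_le (f g : R -> R) (a b E : R) : a <= b ->
  ex_RInt f a b -> ex_RInt g a b -> (forall x, a <= x <= b -> Rabs (f x - g x) <= E) ->
  Rabs (RInt f a b - RInt g a b) <= (b - a) * E.
Proof.
  intros Hab Hf Hg H.
  change (RInt f a b - RInt g a b) with (minus (RInt f a b) (RInt g a b)).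
  rewrite <- (RInt_minus (V:=R_CompleteNormedModule)) by assumption.
  apply abs_RInt_le_const; auto.
  apply (ex_RInt_minus (V:=R_CompleteNormedModule)); assumption.
Qed.

Lemma Re_rect_int_dist_le (F G : C -> C) (a b c d E : R) : a <= b -> c <= d ->
  Cderivable_on_rect F a b c d -> Cderivable_on_rect G a b c d ->
  (forall x y, a <= x <= b -> c <= y <= d -> Cmod (F (x, y) - G (x, y)) <= E) ->
  Rabs (Re_rect_int F a b c d - Re_rect_int G a b c d) <= 2 * ((b - a) + (d - c)) * E.
Proof.
  intros Hab Hcd HF HG H. unfold Re_rect_int.
  assert (Hh : forall y, c <= y <= d ->
    Rabs (RInt (fun x => Re (F (x, y))) a b - RInt (fun x => Re (G (x, y))) a b) <= (b - a) * E).
  { intros y Hy. apply RInt_dist_le; auto.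
    1,2: apply ex_RInt_horizontal; auto.
    intros x Hx. eapply Rle_trans; [|apply (H x y Hx Hy)].
    exact (re_le_Cmod (F (x, y) - G (x, y))%C). }
  assert (Hv : forall x, a <= x <= b ->
    Rabs (RInt (fun y => Im (F (x, y))) c d - RInt (fun y => Im (G (x, y))) c d) <= (d - c) * E).
  { intros x Hx. apply RInt_dist_le; auto.
    1,2: apply ex_RInt_vertical; auto.
    intros y Hy. eapply Rle_trans; [|apply (H x y Hx Hy)].
    exact (im_le_Cmod (F (x, y) - G (x, y))%C). }
  generalize (Hh c ltac:(lra)) (Hh d ltac:(lra)) (Hv a ltac:(lra)) (Hv b ltac:(lra)).
  intros A1 A2 A3 A4. apply Rabs_le_between in A1, A2, A3, A4. apply Rabs_le_between. lra.
Qed.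

(** [p] is the lower left corner of a rectangle of size [2 w x 2 v]; the result is the corner of
    one of its quarters. *)
Definition goursat_next (F : C -> C) (w v : R) (p : R * R) : R * R :=
  let J x y := Rabs (Re_rect_int F x (x + w) y (y + v)) in
  let T := Rabs (Re_rect_int F (fst p) (fst p + 2 * w) (snd p) (snd p + 2 * v)) / 4 in
  if Rle_dec T (J (fst p) (snd p)) then p
  else if Rle_dec T (J (fst p + w) (snd p)) then (fst p + w, snd p)
  else if Rle_dec T (J (fst p) (snd p + v)) then (fst p, snd p + v)
  else (fst p + w, snd p + v).

Lemma goursat_next_spec (F : C -> C) (w v x y : R) : 0 <= w -> 0 <= v ->
  Cderivable_on_rect F x (x + 2 * w) y (y + 2 * v) ->
  let p' := goursat_next F w v (x, y) in
  x <= fst p' <= x + w /\ y <= snd p' <= y + v /\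
  Rabs (Re_rect_int F x (x + 2 * w) y (y + 2 * v)) / 4
    <= Rabs (Re_rect_int F (fst p') (fst p' + w) (snd p') (snd p' + v)).
Proof.
  intros Hw Hv HF p'. unfold p', goursat_next; simpl.
  generalize (Re_rect_int_split4 F x (x + w) (x + 2 * w) y (y + v) (y + 2 * v)
    ltac:(lra) ltac:(lra) HF). intros E.
  repeat match goal with |- context [Rle_dec ?a ?b] => destruct (Rle_dec a b) end;
  simpl; (split; [lra|split; [lra|]]); try assumption.
  replace (x + w + w) with (x + 2 * w) in * by ring.
  replace (y + v + v) with (y + 2 * v) in * by ring.
  repeat match goal with H : ~ _ <= _ |- _ => apply Rnot_le_lt in H end.
  match type of E with ?A = ?B + ?C + (?D + ?G) =>
    generalize (Rabs_triang (B + C) (D + G)) (Rabs_triang B C) (Rabs_triang D G) end.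
  rewrite <- E. lra.
Qed.

Fixpoint goursat_seq (F : C -> C) (w v : R) (p : R * R) (n : nat) : R * R :=
  match n with
  | O => p
  | S n => goursat_next F (w / 2 ^ S n) (v / 2 ^ S n) (goursat_seq F w v p n)
  end.

Lemma nested_limit (x w : nat -> R) :
  (forall n, x n <= x (S n)) -> (forall n, x (S n) + w (S n) <= x n + w n) ->
  (forall n, 0 <= w n) ->
  exists l, forall n, x n <= l <= x n + w n.
Proof.
  intros H1 H2 Hw.
  assert (M1 : forall n k, x n <= x (n + k)%nat).
  { intros n k. induction k. rewrite Nat.add_0_r; lra.
    rewrite Nat.add_succ_r. generalize (H1 (n + k)%nat). lra. }
  assert (M2 : forall n k, x (n + k)%nat + w (n + k)%nat <= x n + w n).
  { intros n k. induction k. rewrite Nat.add_0_r; lra.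
    rewrite Nat.add_succ_r. generalize (H2 (n + k)%nat). lra. }
  assert (B : forall n k, x k <= x n + w n).
  { intros n k. destruct (Nat.le_ge_cases n k).
    - generalize (M2 n (k - n)%nat) (Hw k). replace (n + (k - n))%nat with k by lia. lra.
    - generalize (M1 k (n - k)%nat) (Hw n). replace (k + (n - k))%nat with n by lia. lra. }
  destruct (ex_finite_lim_seq_incr x (x O + w O) H1 (B O)) as [l Hl].
  exists l. intros n. split.
  - apply (is_lim_seq_incr_compare x l Hl H1).
  - apply (is_lim_seq_le x (fun _ => x n + w n) l (x n + w n)); auto.
    apply is_lim_seq_const.
Qed.

Theorem goursat (F : C -> C) (a b c d : R) : a < b -> c < d ->
  Cderivable_on_rect F a b c d -> Re_rect_int F a b c d = 0.
Proof.
  intros Hab Hcd HF.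
  pose (w := b - a). pose (v := d - c).
  pose (s := goursat_seq F w v (a, c)).
  assert (Hwp : forall n, 0 < w / 2 ^ n).
  { intros n. apply Rdiv_lt_0_compat; [unfold w; lra|apply pow_lt; lra]. }
  assert (Hvp : forall n, 0 < v / 2 ^ n).
  { intros n. apply Rdiv_lt_0_compat; [unfold v; lra|apply pow_lt; lra]. }
  assert (H2 : forall u n, u / 2 ^ n = 2 * (u / 2 ^ S n)).
  { intros u n. simpl. field. apply pow_nonzero; lra. }
  pose (J := fun n => Rabs (Re_rect_int F (fst (s n)) (fst (s n) + w / 2 ^ n)
                                        (snd (s n)) (snd (s n) + v / 2 ^ n))).
  assert (Hin : forall n, a <= fst (s n) /\ fst (s n) + w / 2 ^ n <= b /\
                          c <= snd (s n) /\ snd (s n) + v / 2 ^ n <= d /\ J O / 4 ^ n <= J n).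
  { induction n as [|n [I1 [I2 [I3 [I4 I5]]]]].
    - unfold J, s; simpl. unfold w, v. repeat split; lra.
    - generalize (goursat_next_spec F (w / 2 ^ S n) (v / 2 ^ S n) (fst (s n)) (snd (s n))
        ltac:(left; auto) ltac:(left; auto)).
      rewrite <- !H2, <- surjective_pairing.
      change (goursat_next F (w / 2 ^ S n) (v / 2 ^ S n) (s n)) with (s (S n)).
      intros Hs. destruct Hs as [S1 [S2 S3]].
      { intros x y Hx Hy. apply HF; lra. }
      specialize (H2 w n) as E1. specialize (H2 v n) as E2.
      repeat split; try lra.
      apply Rle_trans with (J n / 4); [|exact S3].
      replace (J O / 4 ^ S n) with (J O / 4 ^ n / 4). lra.
      simpl. field. apply pow_nonzero; lra. }
  assert (Hstep : forall n, fst (s n) <= fst (s (S n)) <= fst (s n) + w / 2 ^ S n /\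
                            snd (s n) <= snd (s (S n)) <= snd (s n) + v / 2 ^ S n).
  { intros n. destruct (Hin n) as [I1 [I2 [I3 [I4 _]]]].
    generalize (goursat_next_spec F (w / 2 ^ S n) (v / 2 ^ S n) (fst (s n)) (snd (s n))
        ltac:(left; auto) ltac:(left; auto)).
    rewrite <- !H2, <- surjective_pairing.
    change (goursat_next F (w / 2 ^ S n) (v / 2 ^ S n) (s n)) with (s (S n)).
    intros Hs. destruct Hs as [S1 [S2 _]]; [|auto].
    intros x y Hx Hy. apply HF; lra. }
  destruct (nested_limit (fun n => fst (s n)) (fun n => w / 2 ^ n)) as [x0 Hx0].
  { intros n; apply Hstep. }
  { intros n. generalize (Hstep n) (H2 w n); lra. }
  { intros n; left; auto. }
  destruct (nested_limit (fun n => snd (s n)) (fun n => v / 2 ^ n)) as [y0 Hy0].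
  { intros n; apply Hstep. }
  { intros n. generalize (Hstep n) (H2 v n); lra. }
  { intros n; left; auto. }
  simpl in Hx0, Hy0.
  assert (HF0 : Cderivable F (x0, y0)).
  { apply HF. generalize (Hin O) (Hx0 O). lra. generalize (Hin O) (Hy0 O). lra. }
  destruct (Cderivable_eps _ _ HF0) as [l Hl].
  pose (D := w + v). assert (HD : 0 < D) by (unfold D, w, v; lra).
  assert (HJ : forall eps, 0 < eps -> J O <= eps).
  { intros eps Heps.
    destruct (Hl (eps / (2 * D * D))) as [dl [Hdl Hb]].
    { apply Rdiv_lt_0_compat; [assumption|]. apply Rmult_lt_0_compat; lra. }
    assert (exists n, D / 2 ^ n < dl) as [n Hn].
    { assert (Hhalf : Rabs (/ 2) < 1) by (rewrite Rabs_pos_eq; lra).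
      destruct (pow_lt_1_zero (/ 2) Hhalf (dl / D)) as [n Hn].
      { apply Rdiv_lt_0_compat; assumption. }
      exists n. specialize (Hn n (le_n _)). rewrite Rabs_pos_eq in Hn by (apply pow_le; lra).
      rewrite pow_inv in Hn. apply Rlt_div_r in Hn; [|assumption]. unfold Rdiv; lra. }
    destruct (Hin n) as [I1 [I2 [I3 [I4 I5]]]].
    assert (Hp : 0 < 2 ^ n) by (apply pow_lt; lra).
    assert (EL : J n <= 2 * (D / 2 ^ n) * (eps / (2 * D * D) * (D / 2 ^ n))).
    { unfold J.
      pose (L := fun z : C => ((F (x0, y0) - l * (x0, y0)) + l * z)%C).
      rewrite <- (Rminus_0_r (Re_rect_int _ _ _ _ _)).
      rewrite <- (Re_rect_int_affine (F (x0, y0) - l * (x0, y0)) l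
        (fst (s n)) (fst (s n) + w / 2 ^ n) (snd (s n)) (snd (s n) + v / 2 ^ n)).
      replace (2 * (D / 2 ^ n)) with
        (2 * (fst (s n) + w / 2 ^ n - fst (s n) + (snd (s n) + v / 2 ^ n - snd (s n))))
        by (unfold D; field; lra).
      apply Re_rect_int_dist_le.
      - generalize (Hwp n); lra.
      - generalize (Hvp n); lra.
      - intros x y Hx Hy; apply HF; lra.
      - intros x y Hx Hy. apply Cderivable_plus; [apply Cderivable_const|].
        apply Cderivable_mult; [apply Cderivable_const|apply Cderivable_id].
      - intros x y Hx Hy.
        assert (Hd : Cmod ((x, y) - (x0, y0)) <= D / 2 ^ n).
        { eapply Rle_trans; [apply Cmod_le_Rabs|]. simpl.
          replace (D / 2 ^ n) with (w / 2 ^ n + v / 2 ^ n) by (unfold D; field; lra).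
          specialize (Hx0 n). specialize (Hy0 n).
          apply Rplus_le_compat; apply Rabs_le_between; lra. }
        apply Rle_trans with (eps / (2 * D * D) * Cmod ((x, y) - (x0, y0))).
        + eapply Rle_trans; [|apply (Hb (x, y)); lra].
          right. f_equal. ring.
        + apply Rmult_le_compat_l; [|assumption]. left.
          apply Rdiv_lt_0_compat; [assumption|]. apply Rmult_lt_0_compat; lra. }
    assert (E4 : 4 ^ n = 2 ^ n * 2 ^ n).
    { rewrite <- Rpow_mult_distr. f_equal; ring. }
    replace (2 * (D / 2 ^ n) * (eps / (2 * D * D) * (D / 2 ^ n))) with (eps / 4 ^ n) in EL.
    2:{ rewrite E4. field. split; lra. }
    assert (0 < 4 ^ n) by (apply pow_lt; lra).
    assert (E := Rle_trans _ _ _ I5 EL).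
    apply Rmult_le_reg_r with (/ 4 ^ n); [apply Rinv_0_lt_compat; assumption|exact E]. }
  assert (HJ0 : J O <= 0) by (apply le_epsilon; intros; rewrite Rplus_0_l; auto).
  unfold J, s in HJ0; simpl in HJ0.
  replace (a + w / 1) with b in HJ0 by (unfold w; field).
  replace (c + v / 1) with d in HJ0 by (unfold v; field).
  generalize (Rabs_pos (Re_rect_int F a b c d)). intros.
  destruct (Req_dec (Re_rect_int F a b c d) 0) as [|Hne]; [assumption|].
  apply Rabs_pos_lt in Hne. lra.
Qed.

(** * Maximum principle up to a constant *)

Lemma minus_Ci_div (q u v : R) : 0 < u ^ 2 + v ^ 2 ->
  (- Ci * RtoC q / (u, v))%C = (- (q * v) / (u ^ 2 + v ^ 2), - (q * u) / (u ^ 2 + v ^ 2)).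
Proof.
  intros H. unfold Cdiv, Cinv, Cmult, Copp, Ci, RtoC; simpl.
  f_equal; field; lra.
Qed.

Lemma Cmod_sqr_coord (u v : R) : Cmod (u, v) ^ 2 = u ^ 2 + v ^ 2.
Proof. apply (Cmod2_alt (u, v)). Qed.

(** Expand the square in [(G - G x0)^2 / (z - x0)]: the factor [k] below turns the term
    [(G x0)^2 / (z - x0)] into [- i |G x0|^4 / (z - x0)], to whose integral the four edges contribute
    with the same sign. *)
Lemma rect_max_bound (a x0 b L : R) : a < x0 < b -> 0 < L ->
  exists K, 0 < K /\ forall (G : C -> C) (B : R), Cderivable_on_rect G a b (- L) L ->
    (forall x y, a <= x <= b -> - L <= y <= L -> x = a \/ x = b \/ y = - L \/ y = L ->
      Cmod (G (x, y)) <= B) ->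
    Cmod (G (x0, 0)) <= K * B.
Proof.
  intros Hx0 HL.
  pose (r := Rmin L (Rmin (x0 - a) (b - x0))).
  assert (Hr : 0 < r) by (unfold r; repeat apply Rmin_pos; lra).
  assert (Hr1 : r <= L) by apply Rmin_l.
  assert (Hr2 : r <= x0 - a) by (unfold r; eapply Rle_trans; [apply Rmin_r|apply Rmin_l]).
  assert (Hr3 : r <= b - x0) by (unfold r; eapply Rle_trans; [apply Rmin_r|apply Rmin_r]).
  clearbody r.
  pose (W := (b - a) ^ 2 + L ^ 2).
  assert (HW : 0 < W) by (unfold W; assert (0 < L ^ 2) by (apply pow_lt; assumption); generalize (pow2_ge_0 (b - a)); lra).
  pose (P := 2 * (b - a) + 4 * L). assert (HP : 0 < P) by (unfold P; lra).
  pose (c := L * (b - a) / W * r / P).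
  assert (Hc : 0 < c).
  { unfold c. apply Rdiv_lt_0_compat; [|assumption]. apply Rmult_lt_0_compat; [|assumption].
    apply Rdiv_lt_0_compat; [|assumption]. apply Rmult_lt_0_compat; lra. }
  assert (Hc3 : 0 < 3 / c) by (apply Rdiv_lt_0_compat; lra).
  exists (3 / c + 1). split. lra.
  intros G B HG HB.
  assert (HB0 : 0 <= B).
  { eapply Rle_trans; [apply Cmod_ge_0|apply (HB a 0); lra]. }
  pose (G0 := G (x0, 0)). fold G0. pose (g := Cmod G0). fold g.
  assert (Hg : 0 <= g) by apply Cmod_ge_0.
  destruct (Req_dec g 0) as [Hg0|Hg0].
  { rewrite Hg0. apply Rmult_le_pos; lra. }
  pose (k := (- Ci * (Cconj G0 * Cconj G0))%C).
  pose (H := fun z : C => (k * ((G z - G0) * (G z - G0) / (z - (x0, 0))))%C).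
  assert (HH : Cderivable_on_rect H a b (- L) L).
  { intros x y Hx Hy. unfold H. apply Cderivable_mult; [apply Cderivable_const|].
    apply Cderivable_sqr_quotient. apply HG; assumption. }
  pose (E := g ^ 2 * (B ^ 2 + 2 * g * B) / r).
  assert (Hsplit : forall x y, a <= x <= b -> - L <= y <= L ->
     x = a \/ x = b \/ y = - L \/ y = L ->
     let N := (x - x0) ^ 2 + y ^ 2 in
     0 < N /\ N <= W /\
     - E - g ^ 4 * y / N <= Re (H (x, y)) <= E - g ^ 4 * y / N /\
     - E - g ^ 4 * (x - x0) / N <= Im (H (x, y)) <= E - g ^ 4 * (x - x0) / N).
  { intros x y Hx Hy Hbd N.
    assert (Hr2N : r ^ 2 <= N).
    { unfold N. generalize (pow2_ge_0 (x - x0)) (pow2_ge_0 y). intros.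
      destruct Hbd as [-> |[-> |[-> | ->]]]; nra. }
    assert (HN : 0 < N) by (assert (0 < r ^ 2) by (apply pow_lt; assumption); lra).
    assert (HNW : N <= W) by (unfold N, W; nra).
    split; [assumption|]. split; [assumption|].
    pose (zeta := ((x, y) - (x0, 0))%C).
    assert (Ez : zeta = (x - x0, y)).
    { unfold zeta, Cminus, Cplus, Copp; simpl. f_equal; ring. }
    assert (Hzm : r <= Cmod zeta).
    { apply Rsqr_incr_0_var; [|apply Cmod_ge_0].
      rewrite !Rsqr_pow2, Ez, Cmod_sqr_coord. exact Hr2N. }
    assert (Hz : zeta <> 0) by (apply Cmod_gt_0; lra).
    pose (U := (k * (G (x, y) * G (x, y) - 2 * G0 * G (x, y)) / zeta)%C).
    assert (EH : H (x, y) = Cplus U (- (g ^ 4 * y) / N, - (g ^ 4 * (x - x0)) / N)).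
    { unfold N. rewrite <- minus_Ci_div by exact HN. rewrite <- Ez.
      replace (RtoC (g ^ 4)) with (G0 * G0 * (Cconj G0 * Cconj G0))%C.
      - unfold H, U, k. fold zeta. field. assumption.
      - transitivity ((G0 * Cconj G0) * (G0 * Cconj G0))%C; [ring|].
        rewrite <- Cmod2_conj. fold g. rewrite <- RtoC_mult. f_equal. ring. }
    assert (HU : Cmod U <= E).
    { unfold U, E. rewrite Cmod_div by assumption. unfold Rdiv.
      apply Rmult_le_compat.
      - apply Cmod_ge_0.
      - left; apply Rinv_0_lt_compat; lra.
      - rewrite Cmod_mult.
        assert (Ek : Cmod k = g ^ 2).
        { unfold k. rewrite !Cmod_mult, Cmod_opp, Cmod_Ci, !Cmod_conj. fold g. ring. }
        rewrite Ek. apply Rmult_le_compat_l; [apply pow2_ge_0|].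
        specialize (HB x y Hx Hy Hbd).
        eapply Rle_trans; [apply Cmod_triangle|].
        rewrite Cmod_opp, !Cmod_mult, Cmod_R, Rabs_pos_eq by lra. fold g.
        generalize (Cmod_ge_0 (G (x, y))). intros.
        assert (Cmod (G (x, y)) * Cmod (G (x, y)) <= B * B) by (apply Rmult_le_compat; lra).
        assert (2 * g * Cmod (G (x, y)) <= 2 * g * B) by (apply Rmult_le_compat_l; lra). lra.
      - apply Rinv_le_contravar; lra. }
    assert (H1 := Rle_trans _ _ _ (re_le_Cmod U) HU). apply Rabs_le_between in H1.
    assert (H2 := Rle_trans _ _ _ (im_le_Cmod U) HU). apply Rabs_le_between in H2.
    rewrite EH. clearbody U. destruct U as [u1 u2]. unfold Re, Im in *. cbn [Cplus fst snd] in *.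
    unfold Rdiv in *. rewrite !Ropp_mult_distr_l_reverse. lra. }
  assert (HJ := goursat H a b (- L) L ltac:(lra) ltac:(lra) HH).
  assert (Hg4 : 0 <= g ^ 4) by (apply pow_le; assumption).
  assert (Hbot : (b - a) * (g ^ 4 * L / W - E) <= RInt (fun x => Re (H (x, - L))) a b).
  { replace ((b - a) * (g ^ 4 * L / W - E)) with (RInt (fun _ => g ^ 4 * L / W - E) a b).
    2:{ rewrite RInt_const. reflexivity. }
    apply RInt_le; [lra|apply ex_RInt_const|apply ex_RInt_horizontal; [lra|intros; apply HH; lra]|].
    intros x Hx. destruct (Hsplit x (- L) ltac:(lra) ltac:(lra) ltac:(auto)) as [H1 [H2 [H3 _]]].
    eapply Rle_trans; [|apply H3].
    replace (g ^ 4 * L / W) with (g ^ 4 * L * / W) by reflexivity.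
    assert (/ W <= / ((x - x0) ^ 2 + (- L) ^ 2)) by (apply Rinv_le_contravar; assumption).
    assert (g ^ 4 * L * / W <= g ^ 4 * L * / ((x - x0) ^ 2 + (- L) ^ 2)).
    { apply Rmult_le_compat_l; [|assumption]. apply Rmult_le_pos; lra. }
    unfold Rdiv. lra. }
  assert (Htop : RInt (fun x => Re (H (x, L))) a b <= (b - a) * E).
  { replace ((b - a) * E) with (RInt (fun _ => E) a b).
    2:{ rewrite RInt_const. reflexivity. }
    apply RInt_le; [lra|apply ex_RInt_horizontal; [lra|intros; apply HH; lra]|apply ex_RInt_const|].
    intros x Hx. destruct (Hsplit x L ltac:(lra) ltac:(lra) ltac:(auto)) as [H1 [H2 [H3 _]]].
    eapply Rle_trans; [apply H3|].
    assert (0 <= g ^ 4 * L / ((x - x0) ^ 2 + L ^ 2)).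
    { apply Rdiv_le_0_compat; [|assumption]. apply Rmult_le_pos; lra. }
    lra. }
  assert (Hright : RInt (fun y => Im (H (b, y))) (- L) L <= (L - - L) * E).
  { replace ((L - - L) * E) with (RInt (fun _ => E) (- L) L).
    2:{ rewrite RInt_const. reflexivity. }
    apply RInt_le; [lra|apply ex_RInt_vertical; [lra|intros; apply HH; lra]|apply ex_RInt_const|].
    intros y Hy. destruct (Hsplit b y ltac:(lra) ltac:(lra) ltac:(auto)) as [H1 [H2 [_ H3]]].
    eapply Rle_trans; [apply H3|].
    assert (0 <= g ^ 4 * (b - x0) / ((b - x0) ^ 2 + y ^ 2)).
    { apply Rdiv_le_0_compat; [|assumption]. apply Rmult_le_pos; lra. }
    lra. }
  assert (Hleft : (L - - L) * (- E) <= RInt (fun y => Im (H (a, y))) (- L) L).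
  { replace ((L - - L) * (- E)) with (RInt (fun _ => - E) (- L) L).
    2:{ rewrite RInt_const. reflexivity. }
    apply RInt_le; [lra|apply ex_RInt_const|apply ex_RInt_vertical; [lra|intros; apply HH; lra]|].
    intros y Hy. destruct (Hsplit a y ltac:(lra) ltac:(lra) ltac:(auto)) as [H1 [H2 [_ H3]]].
    eapply Rle_trans; [|apply H3].
    assert (0 <= g ^ 4 * (x0 - a) / ((a - x0) ^ 2 + y ^ 2)).
    { apply Rdiv_le_0_compat; [|assumption]. apply Rmult_le_pos; lra. }
    unfold Rdiv in *. lra. }
  unfold Re_rect_int in HJ.
  assert (Hmain : (b - a) * (g ^ 4 * L / W) <= P * E) by (unfold P; lra).
  assert (Hq : c * g ^ 2 <= B ^ 2 + 2 * g * B).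
  { assert (Hg2 : 0 < g ^ 2) by (apply pow_lt; lra).
    apply Rmult_le_reg_l with (g ^ 2 * P / r).
    { apply Rdiv_lt_0_compat; [|assumption]. apply Rmult_lt_0_compat; assumption. }
    replace (g ^ 2 * P / r * (c * g ^ 2)) with ((b - a) * (g ^ 4 * L / W)) by (unfold c; field; lra).
    replace (g ^ 2 * P / r * (B ^ 2 + 2 * g * B)) with (P * E) by (unfold E; field; lra).
    assumption. }
  destruct (Rle_dec g B) as [HgB|HgB]. nra.
  assert (Hcg : c * g <= 3 * B).
  { apply Rmult_le_reg_l with g; [lra|]. nra. }
  assert (g <= 3 / c * B).
  { apply Rmult_le_reg_l with c; [assumption|].
    replace (c * (3 / c * B)) with (3 * B) by (field; lra). assumption. }
  lra.
Qed.

Lemma Re_plus_pos_Cmod_gt0 (z : C) : 0 < Re z -> z <> 0.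
Proof. intros H E. rewrite E in H. simpl in H. lra. Qed.

(** A two-constant theorem without constants: the weight [((p - x0) / (p - z)) ^ n], with pole
    [p > A], equals 1 at [x0] and is small on the other three sides of
    [[x0 / 2, A] x [- p, p]]. *)
Lemma smallness_propagation (x0 A M eps : R) : 0 < x0 < A -> 0 < eps -> 0 < M ->
  exists delta, 0 < delta /\ forall g : C -> C,
    (forall z, 0 < Re z -> Cderivable g z) ->
    (forall z, 0 < Re z -> Cmod (g z) <= M) ->
    (forall z, A <= Re z -> Cmod (g z) <= delta) ->
    forall z, Re z = x0 -> Cmod (g z) <= eps.
Proof.
  intros Hx Heps HM. pose (p := 2 * A).
  destruct (rect_max_bound (x0 / 2) x0 A p ltac:(lra) ltac:(unfold p; lra)) as [K [HK HKB]].
  pose (q := (p - x0) / (p - x0 / 2)).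
  assert (Hq : 0 < q < 1).
  { unfold q, p; split. apply Rdiv_lt_0_compat; lra. apply Rlt_div_l; lra. }
  destruct (pow_lt_1_zero q ltac:(rewrite Rabs_pos_eq; lra) (eps / K / M)) as [n Hn].
  { repeat apply Rdiv_lt_0_compat; assumption. }
  specialize (Hn n (le_n _)). rewrite Rabs_pos_eq in Hn by (apply pow_le; lra).
  pose (w := (p - x0) / (p - A)).
  assert (Hw : 0 < w) by (unfold w, p; apply Rdiv_lt_0_compat; lra).
  assert (Hwn : 0 < w ^ n) by (apply pow_lt; assumption).
  exists (eps / K / w ^ n). split.
  { repeat apply Rdiv_lt_0_compat; assumption. }
  intros g Hd HgM Hgd [x t] Ht. simpl in Ht. subst x.
  pose (G := fun z : C => (g (1 * z + (0, t)) * (RtoC (p - x0) * / (RtoC p - z)) ^ n)%C).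
  assert (E0 : forall x y, (1 * (x, y) + (0, t))%C = (x, y + t)).
  { intros. unfold Cmult, Cplus; simpl. f_equal; ring. }
  assert (Hne : forall x y, x <= A -> (RtoC p - (x, y))%C <> 0).
  { intros x y Hxy. apply Re_plus_pos_Cmod_gt0. unfold p; simpl. lra. }
  assert (HG0 : G (x0, 0) = g (x0, t)).
  { unfold G. rewrite E0, Rplus_0_l.
    replace (RtoC (p - x0) * / (RtoC p - (x0, 0)))%C with (RtoC 1).
    rewrite Cpow_1_l. ring.
    change (x0, 0) with (RtoC x0). rewrite <- RtoC_minus. field.
    intros E. apply RtoC_inj in E. unfold p in E; lra. }
  rewrite <- HG0.
  replace eps with (K * (eps / K)) by (field; lra).
  apply HKB.
  - intros x y Hxr Hyr. unfold G. apply Cderivable_mult.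
    + apply Cderivable_affine. rewrite E0. apply Hd. simpl. lra.
    + apply (Cderivable_pow (fun z => RtoC (p - x0) * / (RtoC p - z))%C).
      apply Cderivable_mult; [apply Cderivable_const|].
      apply (Cderivable_inv (fun z => RtoC p - z)%C); [|apply Hne; lra].
      apply Cderivable_minus; auto using Cderivable_const, Cderivable_id.
  - intros x y Hxr Hyr Hbd. unfold G. rewrite Cmod_mult, E0, Cmod_pow, Cmod_mult.
    rewrite Cmod_inv by (apply Hne; lra). rewrite Cmod_R, Rabs_pos_eq by (unfold p; lra).
    set (m := Cmod (RtoC p - (x, y))%C).
    destruct (Req_dec x A) as [->|HxA].
    + assert (Hm : p - A <= m).
      { eapply Rle_trans; [|apply re_le_Cmod]. simpl. eapply Rle_trans; [|apply Rle_abs]. lra. }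
      assert (Hmp : 0 < m) by (unfold p in *; lra).
      replace (eps / K) with (eps / K / w ^ n * w ^ n) by (field; lra).
      apply Rmult_le_compat; [apply Cmod_ge_0|apply pow_le|apply Hgd; simpl; lra|].
      { apply Rmult_le_pos; [unfold p; lra|left; apply Rinv_0_lt_compat; assumption]. }
      apply pow_incr. split.
      { apply Rmult_le_pos; [unfold p; lra|left; apply Rinv_0_lt_compat; assumption]. }
      apply Rmult_le_compat_l; [unfold p; lra|]. apply Rinv_le_contravar; [unfold p; lra|assumption].
    + assert (Hm : p - x0 / 2 <= m).
      { destruct Hbd as [->|[Hbd|Hbd]]; [|contradiction|].
        - eapply Rle_trans; [|apply re_le_Cmod]. simpl. eapply Rle_trans; [|apply Rle_abs]. lra.
        - eapply Rle_trans; [|apply im_le_Cmod]. simpl.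
          replace (0 + - y) with (- y) by ring. rewrite Rabs_Ropp.
          destruct Hbd as [->| ->]; [rewrite Rabs_Ropp|]; rewrite Rabs_pos_eq; lra. }
      assert (Hmp : 0 < m) by (unfold p in *; lra).
      apply Rle_trans with (M * q ^ n).
      * apply Rmult_le_compat; [apply Cmod_ge_0|apply pow_le|apply HgM; simpl; lra|].
        { apply Rmult_le_pos; [unfold p; lra|left; apply Rinv_0_lt_compat; assumption]. }
        apply pow_incr. split.
        { apply Rmult_le_pos; [unfold p; lra|left; apply Rinv_0_lt_compat; assumption]. }
        apply Rmult_le_compat_l; [unfold p; lra|]. apply Rinv_le_contravar; [unfold p; lra|assumption].
      * left. apply Rlt_div_r in Hn; [|assumption]. lra.
Qed.

Lemma rhp_modulus_of_continuity : exists K, 0 < K /\ forall (f : C -> C) (M sigma rho t : R),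
  0 < sigma -> Rabs (rho - 1) <= / 4 ->
  (forall z, 0 < Re z -> Cderivable f z) ->
  (forall z, 0 < Re z -> Cmod (f z) <= M) ->
  Cmod (f (sigma * rho, t)%R - f (sigma, t)) ^ 2 <= K * M ^ 2 * Rabs (rho - 1).
Proof.
  destruct (rect_max_bound (/ 2) 1 (3 / 2) 1 ltac:(lra) ltac:(lra)) as [K [HK HKB]].
  exists (16 * K). split; [lra|]. intros f M sigma rho t Hs Hrho Hd HM.
  assert (HM0 : 0 <= M).
  { eapply Rle_trans; [apply Cmod_ge_0|apply (HM (sigma, t) Hs)]. }
  apply Rabs_le_between in Hrho.
  destruct (Req_dec rho 1) as [->|Hr1].
  { replace (sigma * 1) with sigma by ring.
    replace (f (sigma, t) - f (sigma, t))%C with (RtoC 0) by ring.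
    rewrite Cmod_0. replace (1 - 1) with 0 by ring. rewrite Rabs_R0. lra. }
  pose (h := fun z : C => f (RtoC sigma * z + (0, t))%C).
  pose (G := fun z : C => ((h z - h (RtoC rho)) * (h z - h (RtoC rho)) / (z - RtoC rho))%C).
  assert (E0 : forall x y, (RtoC sigma * (x, y) + (0, t))%C = (sigma * x, sigma * y + t)).
  { intros. unfold Cmult, Cplus; simpl. f_equal; ring. }
  assert (Hh : forall x y, 0 < x -> Cmod (h (x, y)) <= M).
  { intros x y Hxy. unfold h. rewrite E0. apply HM. simpl. apply Rmult_lt_0_compat; assumption. }
  assert (HG1 : Cmod (G (1, 0)) <= K * (16 * M ^ 2)).
  { apply HKB.
    - intros x y Hxr Hyr. apply Cderivable_sqr_quotient. apply Cderivable_affine.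
      rewrite E0. apply Hd. simpl. apply Rmult_lt_0_compat; lra.
    - intros x y Hxr Hyr Hbd. unfold G.
      assert (Hm : / 4 <= Cmod ((x, y) - RtoC rho)%C).
      { destruct Hbd as [Hbd|[Hbd|Hbd]].
        1,2: eapply Rle_trans; [|apply re_le_Cmod]; simpl; subst x.
        - rewrite <- Rabs_Ropp. eapply Rle_trans; [|apply Rle_abs]. lra.
        - eapply Rle_trans; [|apply Rle_abs]. lra.
        - eapply Rle_trans; [|apply im_le_Cmod]. simpl.
          replace (y + - 0) with y by ring.
          destruct Hbd as [->| ->]; [rewrite Rabs_Ropp|]; rewrite Rabs_pos_eq; lra. }
      assert (Hne : ((x, y) - RtoC rho)%C <> 0) by (apply Cmod_gt_0; lra).
      rewrite Cmod_div, Cmod_mult by assumption. apply Rle_div_l; [lra|].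
      assert (H2M : Cmod (h (x, y) - h (RtoC rho)) <= 2 * M).
      { eapply Rle_trans; [apply Cmod_triangle|]. rewrite Cmod_opp.
        generalize (Hh x y ltac:(lra)) (Hh rho 0 ltac:(lra)). unfold RtoC. lra. }
      apply Rle_trans with (2 * M * (2 * M)).
      { apply Rmult_le_compat; auto using Cmod_ge_0. }
      generalize (pow2_ge_0 M). nra. }
  assert (Hne : ((1, 0) - RtoC rho)%C <> 0).
  { change (1, 0) with (RtoC 1). rewrite <- RtoC_minus. intros E. apply RtoC_inj in E. lra. }
  unfold G in HG1. rewrite Cmod_div, Cmod_mult in HG1 by assumption.
  apply (proj1 (Rle_div_l _ _ _ (proj1 (Cmod_gt_0 _) Hne))) in HG1.
  replace (Cmod ((1, 0) - RtoC rho)%C) with (Rabs (rho - 1)) in HG1.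
  2:{ change (1, 0) with (RtoC 1). rewrite <- RtoC_minus, Cmod_R, <- Rabs_Ropp. f_equal; ring. }
  unfold h in HG1. change (RtoC rho) with (rho, 0) in HG1. rewrite !E0 in HG1.
  replace (sigma * 1) with sigma in HG1 by ring.
  replace (sigma * 0 + t) with t in HG1 by ring.
  rewrite Cmod_minus_sym. simpl pow in *. lra.
Qed.

(** * Almost periods of Dirichlet series *)

Definition infinitely_many (P : nat -> Prop) : Prop := forall m, exists n, (m <= n)%nat /\ P n.

Lemma infinitely_many_or (P Q : nat -> Prop) :
  infinitely_many (fun n => P n \/ Q n) -> infinitely_many P \/ infinitely_many Q.
Proof.
  intros H. apply NNPP. intros Hn. apply not_or_and in Hn as [HP HQ].
  apply not_all_ex_not in HP as [m HP]. apply not_all_ex_not in HQ as [k HQ].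
  destruct (H (Nat.max m k)) as [n [Hn [Hp|Hq]]].
  - apply HP. exists n. split; [lia|assumption].
  - apply HQ. exists n. split; [lia|assumption].
Qed.

Lemma infinitely_many_close (u : nat -> R) (eta lo : R) (k : nat) (P : nat -> Prop) :
  0 < eta -> infinitely_many P -> (forall n, P n -> lo <= u n <= lo + INR k * eta) ->
  exists Q : nat -> Prop, infinitely_many Q /\ (forall n, Q n -> P n) /\
    forall p q, Q p -> Q q -> Rabs (u p - u q) <= eta.
Proof.
  intros Heta. revert lo P. induction k as [|k IH]; intros lo P HP Hu.
  - exists P. split; [assumption|]. split; [auto|]. intros p q Hp Hq.
    simpl in Hu. generalize (Hu p Hp) (Hu q Hq). intros. apply Rabs_le_between. lra.
  - destruct (infinitely_many_or (fun n => P n /\ u n <= lo + eta) (fun n => P n /\ lo + eta <= u n))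
      as [H|H].
    + intros m. destruct (HP m) as [n [Hn Hp]]. exists n. split; [assumption|].
      destruct (Rle_dec (u n) (lo + eta)); [left|right]; split; auto. lra.
    + eexists; split; [exact H|]. split; [tauto|]. intros p q [Hp Hp'] [Hq Hq'].
      generalize (Hu p Hp) (Hu q Hq). intros. apply Rabs_le_between. lra.
    + destruct (IH (lo + eta) _ H) as [Q [H1 [H2 H3]]].
      * intros n [Hn Hn']. split; [assumption|]. generalize (Hu n Hn). rewrite S_INR. lra.
      * exists Q. split; [assumption|]. split; [|assumption]. intros n Hq. apply (H2 n Hq).
Qed.

Lemma infinitely_many_close_family (u : nat -> nat -> R) (eta : R) (N : nat) (P : nat -> Prop) :
  0 < eta -> infinitely_many P -> (forall j n, -1 <= u j n <= 1) ->
  exists Q : nat -> Prop, infinitely_many Q /\ (forall n, Q n -> P n) /\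
    forall j p q, (j < N)%nat -> Q p -> Q q -> Rabs (u j p - u j q) <= eta.
Proof.
  intros Heta HP Hu. induction N as [|N [Q [H1 [H2 H3]]]].
  - exists P. split; [assumption|]. split; [auto|]. intros; lia.
  - destruct (INR_unbounded (2 / eta)) as [k Hk].
    destruct (infinitely_many_close (u N) eta (-1) k Q Heta H1) as [Q' [G1 [G2 G3]]].
    { intros n _. generalize (Hu N n). apply Rlt_div_l in Hk; lra. }
    exists Q'. split; [assumption|]. split; [auto|]. intros j p q Hj Hp Hq.
    destruct (Nat.eq_dec j N) as [->|]; [auto|]. apply H3; auto. lia.
Qed.

Lemma Cexp_plus (z w : C) : Cexp (z + w) = (Cexp z * Cexp w)%C.
Proof.
  destruct z as [a b], w as [c d]. unfold Cexp, Cmult, Cplus; simpl.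
  rewrite exp_plus, cos_plus, sin_plus. f_equal; ring.
Qed.

Lemma Cmod_Cexp (z : C) : Cmod (Cexp z) = exp (Re z).
Proof.
  unfold Cmod, Cexp; cbn [fst snd].
  replace ((exp (Re z) * cos (Im z)) ^ 2 + (exp (Re z) * sin (Im z)) ^ 2) with
    (exp (Re z) ^ 2 * (Rsqr (sin (Im z)) + Rsqr (cos (Im z)))) by (unfold Rsqr; ring).
  rewrite sin2_cos2, Rmult_1_r. apply sqrt_pow2. left; apply exp_pos.
Qed.

Lemma nat_cpow_opp_plus (n : nat) (s w : C) :
  nat_cpow_opp n (s + w) = (nat_cpow_opp n s * nat_cpow_opp n w)%C.
Proof. unfold nat_cpow_opp. rewrite <- Cexp_plus. f_equal. ring. Qed.

Lemma Cmod_nat_cpow_opp (n : nat) (s : C) :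
  Cmod (nat_cpow_opp n s) = exp (- (Re s * ln (INR n))).
Proof. unfold nat_cpow_opp. rewrite Cmod_Cexp. f_equal. destruct s; simpl. ring. Qed.

Lemma Cmod_nat_cpow_opp_im (n : nat) (t : R) : Cmod (nat_cpow_opp n (0, t)) = 1.
Proof. rewrite Cmod_nat_cpow_opp. simpl. rewrite Rmult_0_l, Ropp_0. apply exp_0. Qed.

(** An error proportional to the index is harmless for an absolutely convergent Dirichlet series,
    and leaves only finitely many indices to be taken care of. *)
Lemma exists_almost_period (eta T : R) : 0 < eta -> 0 < T ->
  exists tau, T <= tau /\
    forall n, Cmod (nat_cpow_opp (S n) (0, tau) - 1) <= eta * INR (S n).
Proof.
  intros Heta HT. destruct (INR_unbounded (2 / eta)) as [N HN].
  pose (z := fun j p => nat_cpow_opp (S j) (0, T * INR p)).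
  destruct (infinitely_many_close_family (fun j p => Re (z j p)) (eta / 2) N (fun _ => True))
    as [Q [HQ [_ Hre]]].
  { lra. }
  { intros m; exists m; auto. }
  { intros j n. apply Rabs_le_between. unfold z.
    rewrite <- (Cmod_nat_cpow_opp_im (S j) (T * INR n)). apply re_le_Cmod. }
  destruct (infinitely_many_close_family (fun j p => Im (z j p)) (eta / 2) N Q)
    as [Q' [HQ' [Hsub Him]]].
  { lra. }
  { assumption. }
  { intros j n. apply Rabs_le_between. unfold z.
    rewrite <- (Cmod_nat_cpow_opp_im (S j) (T * INR n)). apply im_le_Cmod. }
  destruct (HQ' O) as [p [_ Hp]]. destruct (HQ' (S p)) as [q [Hpq Hq]].
  apply le_INR in Hpq. rewrite S_INR in Hpq.
  exists (T * INR q - T * INR p). split. nra.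
  intros n. assert (Hn1 : 1 <= INR (S n)) by (rewrite S_INR; generalize (pos_INR n); lra).
  destruct (Nat.lt_ge_cases n N) as [Hn|Hn].
  - apply Rle_trans with eta; [|nra].
    replace (Cmod (nat_cpow_opp (S n) (0, T * INR q - T * INR p)%R - 1))
      with (Cmod (z n q - z n p)).
    + eapply Rle_trans; [apply Cmod_le_Rabs|].
      generalize (Hre n q p Hn (Hsub _ Hq) (Hsub _ Hp)) (Him n q p Hn Hq Hp).
      change (Re (z n q - z n p)) with (Re (z n q) - Re (z n p)).
      change (Im (z n q - z n p)) with (Im (z n q) - Im (z n p)). intros H1 H2.
      replace eta with (eta / 2 + eta / 2) by lra. apply Rplus_le_compat; assumption.
    + unfold z.
      replace (0, T * INR q) with (Cplus (0, T * INR p) (0, T * INR q - T * INR p)).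
      2:{ unfold Cplus; simpl. f_equal; ring. }
      rewrite nat_cpow_opp_plus.
      match goal with |- Cmod (?a * ?b - _) = _ => replace (a * b - a)%C with (a * (b - 1))%C by ring end.
      rewrite Cmod_mult, Cmod_nat_cpow_opp_im. ring.
  - apply Rle_trans with 2.
    + eapply Rle_trans; [apply Cmod_triangle|]. rewrite Cmod_opp, Cmod_1, Cmod_nat_cpow_opp_im. lra.
    + apply le_INR in Hn. rewrite S_INR. apply Rlt_div_l in HN; [|assumption].
      assert (eta * INR N <= eta * (INR n + 1)) by (apply Rmult_le_compat_l; lra). lra.
Qed.

Lemma sum_inv_sqr_le (N : nat) :
  sum_n (fun k => / INR (S k) ^ 2) N <= 2 - / INR (S N).
Proof.
  induction N as [|N IH].
  - rewrite sum_O. simpl. lra.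
  - rewrite sum_Sn.
    match goal with |- plus ?a ?b <= _ => change (a + b <= 2 - / INR (S (S N))) end.
    assert (H : 0 < INR (S N)) by (apply lt_0_INR; lia).
    rewrite (S_INR (S N)).
    assert (/ (INR (S N) + 1) ^ 2 <= / INR (S N) - / (INR (S N) + 1)); [|lra].
    replace (/ INR (S N) - / (INR (S N) + 1)) with (/ (INR (S N) * (INR (S N) + 1))) by (field; lra).
    apply Rinv_le_contravar; nra.
Qed.

Lemma norm_series_le (u : nat -> C) (b : nat -> R) (l : C) (B : R) :
  @is_series C_AbsRing C_NormedModule u l -> (forall n, Cmod (u n) <= b n) ->
  (forall N, sum_n b N <= B) -> Cmod l <= B.
Proof.
  intros Hu Hb HB.
  assert (Hl : is_lim_seq (fun N => @norm C_AbsRing C_NormedModule (sum_n u N)) (Cmod l)).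
  { apply (filterlim_comp _ _ _ (sum_n u) (@norm C_AbsRing C_NormedModule) _ _ _ Hu).
    apply (filterlim_norm (V:=C_NormedModule)). }
  apply (is_lim_seq_le (fun N => norm (sum_n u N)) (fun _ => B) (Cmod l) B); auto.
  2: apply is_lim_seq_const.
  intros N. eapply Rle_trans; [|apply (HB N)].
  eapply Rle_trans; [apply (norm_sum_n_m (V:=C_NormedModule))|].
  apply sum_n_m_le. exact Hb.
Qed.

Lemma series_terms_bounded (u : nat -> C) (l : C) :
  @is_series C_AbsRing C_NormedModule u l -> exists M, forall n, Cmod (u n) <= M.
Proof.
  intros Hu.
  destruct (filterlim_bounded (V:=C_NormedModule) (sum_n u)) as [M HM].
  { exists l. exact Hu. }
  exists (2 * M). intros [|n].
  - specialize (HM O). rewrite sum_O in HM. change (Cmod (u O) <= M) in HM.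
    generalize (Cmod_ge_0 (u O)). lra.
  - assert (H1 := HM n). assert (H2 := HM (S n)). rewrite sum_Sn in H2.
    change (Cmod (sum_n (G:=C_NormedModule) u n) <= M) in H1.
    change (Cmod (sum_n (G:=C_NormedModule) u n + u (S n))%C <= M) in H2.
    generalize (Cmod_minus_ge (u (S n)) (- sum_n (G:=C_NormedModule) u n)).
    rewrite Cmod_opp.
    replace (u (S n) - - sum_n (G:=C_NormedModule) u n)%C
      with (sum_n (G:=C_NormedModule) u n + u (S n))%C by ring. lra.
Qed.

Lemma dirichlet_translation_bound (f : C -> C) : represented_by_dirichlet_series f ->
  exists K A, 0 < K /\ 0 < A /\ forall eta tau,
    (forall n, Cmod (nat_cpow_opp (S n) (0, tau) - 1) <= eta * INR (S n)) ->
    forall s : C, A <= Re s -> Cmod (f (s + (0, tau))%C - f s) <= K * eta.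
Proof.
  intros [a [theta [Hth Ha]]].
  pose (A0 := theta + 1).
  assert (Hs0 := Ha (A0, 0) ltac:(unfold A0; simpl; lra)).
  destruct (series_terms_bounded _ _ Hs0) as [M HM].
  assert (HM0 : 0 <= M) by (eapply Rle_trans; [apply Cmod_ge_0|apply (HM O)]).
  exists (2 * M + 1), (A0 + 3). split; [lra|]. split; [unfold A0; lra|].
  intros eta tau Htau s Hs.
  assert (Heta : 0 <= eta).
  { specialize (Htau O). simpl INR in Htau. generalize (Cmod_ge_0 (nat_cpow_opp 1 (0, tau) - 1)). lra. }
  assert (Hd := is_series_minus (V:=C_NormedModule) _ _ _ _
     (Ha (s + (0, tau))%C ltac:(unfold A0 in *; destruct s; simpl in *; lra))
     (Ha s ltac:(unfold A0 in *; destruct s; simpl in *; lra))).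
  apply Rle_trans with (M * eta * 2); [|nra].
  apply (norm_series_le _ (fun n => M * eta * / INR (S n) ^ 2) _ _ Hd).
  - intros n.
    match goal with |- Cmod ?x <= _ => replace x with
      ((a n * nat_cpow_opp (S n) (A0, 0%R)) * nat_cpow_opp (S n) (s - (A0, 0%R)) * (nat_cpow_opp (S n) (0%R, tau) - 1))%C end.
    2:{ rewrite nat_cpow_opp_plus.
        replace (nat_cpow_opp (S n) s) with
          (nat_cpow_opp (S n) (A0, 0%R) * nat_cpow_opp (S n) (s - (A0, 0%R)))%C.
        - match goal with |- _ = plus ?a (opp ?b) => change (plus a (opp b)) with (a - b)%C end. ring.
        - rewrite <- nat_cpow_opp_plus. f_equal. ring. }
    assert (Hn : 1 <= INR (S n)) by (rewrite S_INR; generalize (pos_INR n); lra).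
    rewrite Cmod_mult, (Cmod_mult (a n * nat_cpow_opp (S n) (A0, 0))).
    replace (M * eta * / INR (S n) ^ 2) with (M * / INR (S n) ^ 3 * (eta * INR (S n))) by (field; lra).
    apply Rmult_le_compat; auto using Cmod_ge_0.
    { apply Rmult_le_pos; apply Cmod_ge_0. }
    apply Rmult_le_compat; auto using Cmod_ge_0.
    rewrite Cmod_nat_cpow_opp.
    assert (Hln : 0 <= ln (INR (S n))) by (rewrite <- ln_1; apply ln_le; lra).
    apply Rle_trans with (exp (- (3 * ln (INR (S n))))).
    + destruct s as [x y]; simpl Re in *.
      assert (E : - ((x + - A0) * ln (INR (S n))) <= - (3 * ln (INR (S n)))).
      { apply Ropp_le_contravar. apply Rmult_le_compat_r; lra. }
      simpl fst in *. destruct E as [E|E]; [left; apply exp_increasing; exact E|rewrite E; lra].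
    + rewrite exp_Ropp. right. f_equal.
      replace (3 * ln (INR (S n))) with (ln (INR (S n)) + ln (INR (S n)) + ln (INR (S n))) by ring.
      rewrite !exp_plus, exp_ln by lra. ring.
  - intros N.
    replace (sum_n (fun n => M * eta * / INR (S n) ^ 2) N)
      with (M * eta * sum_n (fun n => / INR (S n) ^ 2) N).
    + apply Rmult_le_compat_l; [apply Rmult_le_pos; assumption|].
      eapply Rle_trans; [apply sum_inv_sqr_le|].
      assert (0 < / INR (S N)) by (apply Rinv_0_lt_compat, lt_0_INR; lia). lra.
    + symmetry. apply (sum_n_mult_l (K:=R_AbsRing)).
Qed.

(** * Interpolation at sparse points *)

Definition Csummable (u : nat -> C) : Prop := ex_series (fun n => Cmod (u n)).

Definition csum (u : nat -> C) : C := (Series (fun n => Re (u n)), Series (fun n => Im (u n))).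

Lemma Csummable_le (u : nat -> C) (v : nat -> R) :
  (forall n, Cmod (u n) <= v n) -> ex_series v -> Csummable u.
Proof.
  intros H Hv. apply (ex_series_le (V:=R_CompleteNormedModule) _ v); [|assumption].
  intros n. change (Rabs (Cmod (u n)) <= v n). rewrite Rabs_pos_eq; auto using Cmod_ge_0.
Qed.

Lemma Csummable_Re_Im (u : nat -> C) : Csummable u ->
  ex_series (fun n => Re (u n)) /\ ex_series (fun n => Im (u n)).
Proof.
  intros H. split; apply (ex_series_le (V:=R_CompleteNormedModule) _ _) with (2 := H).
  - intros n. apply (re_le_Cmod (u n)).
  - intros n. apply (im_le_Cmod (u n)).
Qed.

Lemma Rabs_Series_le (u v : nat -> R) :
  (forall n, Rabs (u n) <= v n) -> ex_series v -> Rabs (Series u) <= Series v.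
Proof.
  intros H Hv. eapply Rle_trans; [apply Series_Rabs|].
  - apply (ex_series_le (V:=R_CompleteNormedModule) _ v); [|assumption].
    intros n. change (Rabs (Rabs (u n)) <= v n). rewrite Rabs_Rabsolu. apply H.
  - apply Series_le; [|assumption]. intros n. split; [apply Rabs_pos|apply H].
Qed.

Lemma Cmod_csum_le (u : nat -> C) (v : nat -> R) :
  (forall n, Cmod (u n) <= v n) -> ex_series v -> Cmod (csum u) <= 2 * Series v.
Proof.
  intros H Hv. eapply Rle_trans; [apply Cmod_le_Rabs|]. simpl.
  assert (Rabs (Series (fun n => Re (u n))) <= Series v).
  { apply Rabs_Series_le; [|assumption]. intros n. eapply Rle_trans; [apply re_le_Cmod|apply H]. }
  assert (Rabs (Series (fun n => Im (u n))) <= Series v).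
  { apply Rabs_Series_le; [|assumption]. intros n. eapply Rle_trans; [apply im_le_Cmod|apply H]. }
  lra.
Qed.

Lemma csum_ext (u v : nat -> C) : (forall n, u n = v n) -> csum u = csum v.
Proof. intros H. unfold csum. f_equal; apply Series_ext; intros n; rewrite H; reflexivity. Qed.

Lemma csum_plus (u v : nat -> C) : Csummable u -> Csummable v ->
  csum (fun n => u n + v n)%C = (csum u + csum v)%C.
Proof.
  intros Hu Hv. apply Csummable_Re_Im in Hu as [], Hv as [].
  unfold csum, Cplus; simpl. f_equal; rewrite <- Series_plus; auto.
Qed.

Lemma Csummable_scal (c : C) (u : nat -> C) : Csummable u -> Csummable (fun n => c * u n)%C.
Proof.
  intros Hu. apply (Csummable_le _ (fun n => Cmod c * Cmod (u n))).
  - intros n. rewrite Cmod_mult. lra.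
  - apply (ex_series_scal (V:=R_NormedModule)); assumption.
Qed.

Lemma csum_scal (c : C) (u : nat -> C) : Csummable u ->
  csum (fun n => c * u n)%C = (c * csum u)%C.
Proof.
  intros Hu. apply Csummable_Re_Im in Hu as [Hr Hi].
  destruct c as [a b].
  assert (Hs : forall (k : R) (x : nat -> R), ex_series x -> ex_series (fun n => k * x n)).
  { intros k x Hx. apply (ex_series_scal (V:=R_NormedModule)). assumption. }
  unfold csum, Cmult; simpl. rewrite <- !Series_scal_l.
  rewrite <- Series_minus, <- Series_plus by auto. reflexivity.
Qed.

Lemma csum_minus (u v : nat -> C) : Csummable u -> Csummable v ->
  csum (fun n => u n - v n)%C = (csum u - csum v)%C.
Proof.
  intros Hu Hv. transitivity (csum (fun n => u n + (-1) * v n)%C).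
  - apply csum_ext. intros; ring.
  - rewrite csum_plus, csum_scal by auto using Csummable_scal. ring.
Qed.

Lemma is_series_delta (m : nat) (x : R) : is_series (fun n => if Nat.eq_dec n m then x else 0) x.
Proof.
  assert (H : forall N, sum_n (fun n => if Nat.eq_dec n m then x else 0) N =
    if le_dec m N then x else 0).
  { induction N as [|N IH].
    - rewrite sum_O. destruct (Nat.eq_dec 0 m), (le_dec m 0); auto; lia.
    - rewrite sum_Sn, IH.
      lazymatch goal with |- plus ?a ?b = ?c => change (@eq R (a + b) c) end.
      destruct (Nat.eq_dec (S N) m), (le_dec m N), (le_dec m (S N)); try lia; ring. }
  apply (filterlim_ext_loc (fun _ => x)).
  - exists m. intros N HN. rewrite H. destruct (le_dec m N); [reflexivity|contradiction].
  - apply filterlim_const.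
Qed.

Lemma csum_delta (m : nat) (x : C) : csum (fun n => if Nat.eq_dec n m then x else 0) = x.
Proof.
  unfold csum. rewrite (surjective_pairing x). f_equal.
  - etransitivity; [|apply is_series_unique, (is_series_delta m (fst x))]. apply Series_ext.
    intros n. destruct (Nat.eq_dec n m); reflexivity.
  - etransitivity; [|apply is_series_unique, (is_series_delta m (snd x))]. apply Series_ext.
    intros n. destruct (Nat.eq_dec n m); reflexivity.
Qed.

Lemma geometric_limit (z : nat -> C) (M : R) : (forall k, Cmod (z (S k) - z k) <= M / 2 ^ k) ->
  exists l, forall k, Cmod (l - z k) <= 4 * M / 2 ^ k.
Proof.
  intros H.
  assert (HM : 0 <= M).
  { specialize (H O). simpl in H. generalize (Cmod_ge_0 (z 1%nat - z 0%nat)%C). lra. }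
  assert (Hp : forall k, 0 < 2 ^ k) by (intros; apply pow_lt; lra).
  assert (HR : forall x : nat -> R, (forall k, Rabs (x (S k) - x k) <= M / 2 ^ k) ->
    exists l, forall k, Rabs (l - x k) <= 2 * M / 2 ^ k).
  { intros x Hx.
    assert (Hd : forall k, 2 * M / 2 ^ S k = M / 2 ^ k /\ 2 * M / 2 ^ k = 2 * (M / 2 ^ k)).
    { intros k. specialize (Hp k). simpl. split; field; lra. }
    destruct (nested_limit (fun k => x k - 2 * M / 2 ^ k) (fun k => 2 * (2 * M / 2 ^ k))) as [l Hl].
    - intros k. specialize (Hx k). apply Rabs_le_between in Hx. destruct (Hd k). lra.
    - intros k. specialize (Hx k). apply Rabs_le_between in Hx. destruct (Hd k). lra.
    - intros k. assert (0 <= 2 * M / 2 ^ k) by (apply Rdiv_le_0_compat; [lra|apply Hp]). lra.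
    - exists l. intros k. apply Rabs_le_between. specialize (Hl k). lra. }
  destruct (HR (fun k => Re (z k))) as [a Ha].
  { intros k. eapply Rle_trans; [|apply H]. apply (re_le_Cmod (z (S k) - z k)%C). }
  destruct (HR (fun k => Im (z k))) as [b Hb].
  { intros k. eapply Rle_trans; [|apply H]. apply (im_le_Cmod (z (S k) - z k)%C). }
  exists (a, b). intros k. eapply Rle_trans; [apply Cmod_le_Rabs|].
  replace (4 * M / 2 ^ k) with (2 * M / 2 ^ k + 2 * M / 2 ^ k) by (field; specialize (Hp k); lra).
  apply Rplus_le_compat; [apply Ha|apply Hb].
Qed.

Definition Cbounded (b : nat -> C) : Prop := exists M, forall n, Cmod (b n) <= M.

Lemma neumann_inverse (E : (nat -> C) -> nat -> C) :
  (forall b b', Cbounded b -> Cbounded b' ->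
    forall m, E (fun n => b n - b' n)%C m = (E b m - E b' m)%C) ->
  (forall b M, (forall n, Cmod (b n) <= M) -> forall m, Cmod (E b m) <= M / 2) ->
  forall alpha, Cbounded alpha ->
  exists b, Cbounded b /\ forall m, (b m + E b m)%C = alpha m.
Proof.
  intros Hlin Hbd alpha [M HM].
  pose (b := fix b k := match k with O => fun _ => RtoC 0 | S k => fun m => (alpha m - E (b k) m)%C end).
  assert (Hb : forall k, Cbounded (b k)).
  { induction k as [|k [N HN]].
    - exists 0. intros n. simpl. rewrite Cmod_0. lra.
    - exists (M + N / 2). intros n. simpl. eapply Rle_trans; [apply Cmod_triangle|].
      rewrite Cmod_opp. apply Rplus_le_compat; auto. }
  assert (Hstep : forall k m, Cmod (b (S k) m - b k m) <= M / 2 ^ k).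
  { induction k as [|k IH]; intros m.
    - simpl. assert (E0 : E (fun _ => RtoC 0) m = 0).
      { assert (H0 : Cmod (E (fun _ => RtoC 0) m) <= 0 / 2).
        { apply Hbd. intros n. rewrite Cmod_0. lra. }
        apply Cmod_eq_0. generalize (Cmod_ge_0 (E (fun _ => RtoC 0) m)). lra. }
      rewrite E0. replace (alpha m - 0 - 0)%C with (alpha m) by ring.
      replace (M / 1) with M by field. apply HM.
    - change (Cmod ((alpha m - E (b (S k)) m) - (alpha m - E (b k) m)) <= M / 2 ^ S k).
      replace ((alpha m - E (b (S k)) m) - (alpha m - E (b k) m))%C
        with (- (E (b (S k)) m - E (b k) m))%C by ring.
      rewrite Cmod_opp, <- Hlin by auto.
      replace (M / 2 ^ S k) with (M / 2 ^ k / 2).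
      + apply Hbd. exact IH.
      + simpl. field. apply pow_nonzero; lra. }
  destruct (functional_choice _ (fun m => geometric_limit (fun k => b k m) M (fun k => Hstep k m)))
    as [c Hc].
  assert (Hcb : Cbounded c).
  { exists (4 * M / 2 ^ 0). intros n. specialize (Hc n O). simpl in Hc.
    replace (c n - 0)%C with (c n) in Hc by ring. exact Hc. }
  exists c. split; [assumption|]. intros m.
  assert (Hz : Cmod (c m + E c m - alpha m) <= 0).
  { apply le_epsilon. intros eps Heps. rewrite Rplus_0_l.
    assert (HM0 : 0 <= M) by (eapply Rle_trans; [apply Cmod_ge_0|apply (HM O)]).
    assert (Hhalf : Rabs (/ 2) < 1) by (rewrite Rabs_pos_eq; lra).
    destruct (pow_lt_1_zero (/ 2) Hhalf (eps / (4 * M + 1))) as [k Hk].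
    { apply Rdiv_lt_0_compat; lra. }
    specialize (Hk k (le_n _)). rewrite Rabs_pos_eq, pow_inv in Hk by (apply pow_le; lra).
    apply Rlt_div_r in Hk; [|lra].
    assert (Hp : 0 < 2 ^ k) by (apply pow_lt; lra).
    assert (Hp' := Rinv_0_lt_compat _ Hp).
    replace (c m + E c m - alpha m)%C with ((c m - b (S k) m) + (E c m - E (b k) m))%C.
    2:{ change (b (S k) m) with (alpha m - E (b k) m)%C. ring. }
    rewrite <- Hlin by auto.
    eapply Rle_trans; [apply Cmod_triangle|].
    assert (H2 := Hbd _ _ (fun n => Hc n k) m).
    assert (H1 := Hc m (S k)).
    replace (4 * M / 2 ^ S k) with (2 * M * / 2 ^ k) in H1 by (simpl; field; lra).
    replace (4 * M / 2 ^ k / 2) with (2 * M * / 2 ^ k) in H2 by (field; lra).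
    cbv beta in *. lra. }
  assert (Hz' : (c m + E c m - alpha m)%C = 0).
  { apply Cmod_eq_0. generalize (Cmod_ge_0 (c m + E c m - alpha m)%C). lra. }
  replace (alpha m) with (c m + E c m - (c m + E c m - alpha m))%C by ring. rewrite Hz'. ring.
Qed.

Lemma half_pow_series : is_series (fun n => (/ 2) ^ n) 2.
Proof.
  assert (H := is_series_geom (/ 2) ltac:(rewrite Rabs_pos_eq; lra)).
  replace (/ (1 - / 2)) with 2 in H by field. exact H.
Qed.

(** A multiple of the reproducing kernel at [sigma + i t]: equal to 1 there and small at all
    points whose imaginary part is far from [t]. *)
Definition rhp_kernel (sigma t : R) (s : C) : C := (RtoC (2 * sigma) / (s + (sigma, - t)%R))%C.

Lemma rhp_kernel_den (sigma t : R) (s : C) : 0 < sigma -> 0 < Re s ->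
  let D := Cmod (s + (sigma, - t)%R) in sigma <= D /\ Re s <= D /\ Rabs (Im s - t) <= D.
Proof.
  intros Hs Hr D.
  assert (H1 := re_le_Cmod (s + (sigma, - t)%R)). assert (H2 := im_le_Cmod (s + (sigma, - t)%R)).
  fold D in H1, H2. destruct s as [x y]. simpl in *.
  assert (H3 := Rle_abs (x + sigma)). unfold Rminus. repeat split; lra.
Qed.

Lemma Cmod_rhp_kernel (sigma t : R) (s : C) : 0 < sigma -> 0 < Re s ->
  Cmod (rhp_kernel sigma t s) = 2 * sigma / Cmod (s + (sigma, - t)%R).
Proof.
  intros Hs Hr. destruct (rhp_kernel_den sigma t s Hs Hr) as [H _].
  unfold rhp_kernel. rewrite Cmod_div.
  - rewrite Cmod_R, Rabs_pos_eq by lra. reflexivity.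
  - apply Cmod_gt_0. lra.
Qed.

Section SparseInterpolation.

Variables (sigma t : nat -> R) (S0 : R).
Hypothesis sigma_bd : forall n, 0 < sigma n <= S0.
Hypothesis t_sep : forall n m, n <> m -> 32 * S0 * 2 ^ n <= Rabs (t n - t m).

Let g (n : nat) : C -> C := rhp_kernel (sigma n) (t n).
Let p (n : nat) : C := (sigma n, t n).

Lemma rhp_kernel_le_far (n : nat) (s : C) (k : R) : 0 < k -> 0 < Re s ->
  2 * S0 * k <= Rabs (Im s - t n) -> Cmod (g n s) <= / k.
Proof.
  intros Hk Hs Hf. unfold g. destruct (sigma_bd n) as [H1 H2]. rewrite Cmod_rhp_kernel by auto.
  destruct (rhp_kernel_den (sigma n) (t n) s H1 Hs) as [H3 [_ H4]].
  apply Rle_div_l; [lra|].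
  apply Rmult_le_reg_l with k; [assumption|].
  match goal with |- _ <= k * (/ k * ?D) => replace (k * (/ k * D)) with D by (field; lra) end.
  assert (k * (2 * sigma n) <= k * (2 * S0)) by (apply Rmult_le_compat_l; lra). lra.
Qed.

Lemma pow2_pos (n : nat) : 0 < 2 ^ n.
Proof. apply pow_lt; lra. Qed.

Lemma kernel_sum_dominated (s : C) : 0 < Re s ->
  exists v : nat -> R, is_series v 4 /\ forall n, Cmod (g n s) <= v n.
Proof.
  intros Hs.
  assert (H2 : forall n, Cmod (g n s) <= 2).
  { intros n. unfold g. destruct (sigma_bd n) as [H1 H2]. rewrite Cmod_rhp_kernel by auto.
    destruct (rhp_kernel_den (sigma n) (t n) s H1 Hs) as [H3 _].
    apply Rle_div_l; lra. }
  assert (Hm : exists m, forall n, n <> m -> Cmod (g n s) <= (/ 2) ^ n).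
  { destruct (classic (exists m, ~ (Cmod (g m s) <= (/ 2) ^ m))) as [[m Hm]|Hm].
    - exists m. intros n Hnm. apply NNPP. intros Hn.
      assert (F : forall j, ~ (Cmod (g j s) <= (/ 2) ^ j) -> Rabs (Im s - t j) < 2 * S0 * 2 ^ j).
      { intros j Hj. apply Rnot_le_lt. intros Hf. apply Hj. rewrite pow_inv.
        apply rhp_kernel_le_far; auto using pow2_pos. }
      assert (F1 := F _ Hm). assert (F2 := F _ Hn).
      assert (T1 := t_sep n m Hnm). assert (T2 := t_sep m n (not_eq_sym Hnm)).
      assert (HS : 0 < S0) by (generalize (sigma_bd O); lra).
      assert (P1 := Rmult_lt_0_compat _ _ HS (pow2_pos n)).
      assert (P2 := Rmult_lt_0_compat _ _ HS (pow2_pos m)).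
      rewrite Rabs_minus_sym in T2.
      assert (Rabs (t n - t m) <= Rabs (Im s - t n) + Rabs (Im s - t m)).
      { rewrite (Rabs_minus_sym (Im s) (t n)).
        replace (t n - t m) with ((t n - Im s) + (Im s - t m)) by ring. apply Rabs_triang. }
      lra.
    - exists O. intros n _. apply NNPP. intros Hn. apply Hm. exists n. exact Hn. }
  destruct Hm as [m Hm].
  exists (fun n => (/ 2) ^ n + if Nat.eq_dec n m then 2 else 0). split.
  - replace 4 with (plus 2 2) by (unfold plus; simpl; ring).
    apply (is_series_plus (V:=R_NormedModule)); [apply half_pow_series|apply is_series_delta].
  - intros n. destruct (Nat.eq_dec n m) as [->|Hn].
    + generalize (H2 m) (pow_le (/ 2) m). lra.
    + generalize (Hm n Hn). lra.
Qed.

Lemma kernel_combination_dominated (b : nat -> C) (M : R) (s : C) :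
  (forall n, Cmod (b n) <= M) -> 0 < Re s ->
  exists v : nat -> R, is_series v (M * 4) /\ forall n, Cmod (b n * g n s) <= v n.
Proof.
  intros HM Hs. destruct (kernel_sum_dominated s Hs) as [v [Hv Hg]].
  exists (fun n => M * v n). split.
  - apply (is_series_scal (V:=R_NormedModule) M v 4 Hv).
  - intros n. rewrite Cmod_mult. apply Rmult_le_compat; auto using Cmod_ge_0.
Qed.

Lemma kernel_combination_summable (b : nat -> C) (s : C) :
  Cbounded b -> 0 < Re s -> Csummable (fun n => b n * g n s)%C.
Proof.
  intros [M HM] Hs. destruct (kernel_combination_dominated b M s HM Hs) as [v [Hv Hb]].
  apply (Csummable_le _ v Hb). eexists; exact Hv.
Qed.

Lemma kernel_combination_Hinfty (b : nat -> C) : Cbounded b ->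
  Hinfty (fun s => csum (fun n => b n * g n s)%C).
Proof.
  intros Hb. destruct Hb as [M HM]. assert (Hb : Cbounded b) by (exists M; exact HM).
  assert (HM0 : 0 <= M) by (eapply Rle_trans; [apply Cmod_ge_0|apply (HM O)]).
  split.
  - intros s Hs. unfold right_half_plane in Hs. set (r := Re s) in *.
    destruct (kernel_combination_dominated b M s HM Hs) as [v [Hv Hbv]].
    pose (c := fun n : nat => (sigma n, - t n) : C).
    assert (Hc : forall n (w : C), 0 < Re w -> Re w <= Cmod (w + c n)).
    { intros n w Hw. apply rhp_kernel_den; [apply sigma_bd|assumption]. }
    pose (u' := fun n => (b n * g n s * - / (s + c n))%C).
    assert (Hu' : Csummable u').
    { apply (Csummable_le _ (fun n => / r * v n)).
      - intros n. unfold u'. rewrite Cmod_mult, Cmod_opp, Rmult_comm.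
        specialize (Hc n s Hs). fold r in Hc.
        apply Rmult_le_compat; auto using Cmod_ge_0.
        rewrite Cmod_inv by (apply Cmod_gt_0; lra). apply Rinv_le_contravar; assumption.
      - apply (ex_series_scal (V:=R_NormedModule)). eexists; exact Hv. }
    exists (csum u'). apply is_derive_C_eps. intros eps Heps.
    pose (K := 16 * M / r ^ 2). assert (Hr2 : 0 < r ^ 2) by (apply pow_lt; assumption).
    assert (HK : 0 <= K) by (apply Rdiv_le_0_compat; lra).
    exists (Rmin (r / 2) (eps / (K + 1))). split.
    { apply Rmin_pos; [lra|]. apply Rdiv_lt_0_compat; lra. }
    intros w Hw.
    assert (Hw1 := Rlt_le_trans _ _ _ Hw (Rmin_l _ _)).
    assert (Hw2 := Rlt_le_trans _ _ _ Hw (Rmin_r _ _)).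
    assert (Hwr : r / 2 <= Re w).
    { generalize (Rle_trans _ _ _ (re_le_Cmod (w - s)) (Rlt_le _ _ Hw1)). intros Ha.
      apply Rabs_le_between in Ha. change (Re (w - s)) with (Re w - Re s) in Ha. fold r in Ha. lra. }
    assert (Hw0 : 0 < Re w) by lra.
    assert (Hsum := kernel_combination_summable b s Hb Hs).
    assert (Hsumw := kernel_combination_summable b w Hb Hw0).
    pose (h := Cmod (w - s)). fold h. fold h in Hw2.
    assert (Hh : 0 <= h) by apply Cmod_ge_0.
    replace (csum (fun n => b n * g n w) - csum (fun n => b n * g n s) - csum u' * (w - s))%C
      with (csum (fun n => b n * g n w - b n * g n s - (w - s) * u' n)%C).
    2:{ rewrite csum_minus, csum_minus, csum_scal; auto using Csummable_scal. ring.
        apply (Csummable_le _ (fun n => Cmod (b n * g n w) + Cmod (b n * g n s))).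
        - intros n. eapply Rle_trans; [apply Cmod_triangle|]. rewrite Cmod_opp. lra.
        - apply (ex_series_plus (V:=R_NormedModule)); assumption. }
    pose (q := h ^ 2 * (2 / r ^ 2)).
    apply Rle_trans with (2 * Series (fun n => q * v n)).
    + apply Cmod_csum_le.
      2:{ apply (ex_series_scal (V:=R_NormedModule)). eexists; exact Hv. }
      intros n. assert (C1 := Hc n s Hs). assert (C2 := Hc n w Hw0). fold r in C1.
      assert (N1 : (s + c n)%C <> 0) by (apply Cmod_gt_0; lra).
      assert (N2 : (w + c n)%C <> 0) by (apply Cmod_gt_0; lra).
      replace (b n * g n w - b n * g n s - (w - s) * u' n)%C with
        ((w - s) * (w - s) / ((w + c n) * (s + c n)) * (b n * g n s))%C.
      2:{ unfold u', g, rhp_kernel. change ((sigma n, - t n) : C) with (c n). field. auto. }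
      rewrite Cmod_mult. apply Rmult_le_compat; auto using Cmod_ge_0.
      rewrite Cmod_div by (apply Cmult_neq_0; assumption). rewrite !Cmod_mult. fold h.
      unfold q. replace (h * h) with (h ^ 2) by ring. unfold Rdiv.
      apply Rmult_le_compat_l; [apply pow2_ge_0|].
      replace (2 * / r ^ 2) with (/ (r / 2 * r)) by (field; lra).
      apply Rinv_le_contravar.
      * apply Rmult_lt_0_compat; lra.
      * apply Rmult_le_compat; lra.
    + rewrite Series_scal_l, (is_series_unique _ _ Hv).
      replace (2 * (q * (M * 4))) with (K * h * h) by (unfold q, K; field; lra).
      apply Rmult_le_compat_r; [assumption|].
      apply Rlt_div_r in Hw2; [|lra]. lra.
  - exists (2 * (M * 4)). intros s Hs.
    destruct (kernel_combination_dominated b M s HM Hs) as [v [Hv Hbv]].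
    rewrite <- (is_series_unique _ _ Hv). apply Cmod_csum_le; [assumption|]. eexists; exact Hv.
Qed.

Lemma sparse_interpolating : interpolating Hinfty p.
Proof.
  intros alpha Halpha.
  assert (HS : 0 < S0) by (generalize (sigma_bd O); lra).
  assert (Hp : forall m, 0 < Re (p m)) by (intros m; apply sigma_bd).
  pose (off := fun b m n => if Nat.eq_dec n m then RtoC 0 else (b n * g n (p m))%C).
  assert (Hoff : forall b M, (forall n, Cmod (b n) <= M) -> forall m n,
    Cmod (off b m n) <= M * / 16 * (/ 2) ^ n).
  { intros b M HM m n.
    assert (HM0 : 0 <= M) by (eapply Rle_trans; [apply Cmod_ge_0|apply (HM O)]).
    unfold off. rewrite pow_inv.
    assert (Hi := Rinv_0_lt_compat _ (pow2_pos n)).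
    destruct (Nat.eq_dec n m) as [_|Hnm].
    - rewrite Cmod_0. repeat apply Rmult_le_pos; lra.
    - rewrite Cmod_mult, Rmult_assoc. apply Rmult_le_compat; auto using Cmod_ge_0.
      rewrite <- Rinv_mult. apply rhp_kernel_le_far; [generalize (pow2_pos n); lra|apply Hp|].
      unfold p; simpl Im. rewrite Rabs_minus_sym. eapply Rle_trans; [|apply t_sep; exact Hnm].
      right. ring. }
  assert (Hgeom : forall k, ex_series (fun n => k * (/ 2) ^ n)).
  { intros k. apply (ex_series_scal (V:=R_NormedModule)). eexists. apply half_pow_series. }
  assert (Hoffs : forall b, Cbounded b -> forall m, Csummable (off b m)).
  { intros b [M HM] m. apply (Csummable_le _ _ (Hoff b M HM m) (Hgeom _)). }
  destruct (neumann_inverse (fun b m => csum (off b m))) with (alpha := alpha) as [b [Hb Heq]].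
  - intros b b' Hb Hb' m. rewrite <- csum_minus by auto. apply csum_ext.
    intros n. unfold off. destruct (Nat.eq_dec n m); ring.
  - intros b M HM m.
    assert (HM0 : 0 <= M) by (eapply Rle_trans; [apply Cmod_ge_0|apply (HM O)]).
    eapply Rle_trans; [apply (Cmod_csum_le _ _ (Hoff b M HM m) (Hgeom _))|].
    rewrite (Series_scal_l _ (pow (/ 2))), (is_series_unique (pow (/ 2)) 2 half_pow_series). lra.
  - exact Halpha.
  - exists (fun s => csum (fun n => b n * g n s)%C). split.
    + apply kernel_combination_Hinfty; assumption.
    + intros m. rewrite <- Heq.
      rewrite <- (csum_delta m (b m)) at 1. rewrite <- csum_plus.
      * apply csum_ext. intros n. unfold off. destruct (Nat.eq_dec n m) as [->|_]; [|ring].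
        unfold g, rhp_kernel, p.
        replace (Cplus (sigma m, t m) (sigma m, - t m)) with (RtoC (2 * sigma m)).
        2:{ unfold Cplus, RtoC; simpl. f_equal; ring. }
        rewrite Cplus_0_r. field. intros E. apply RtoC_inj in E. generalize (sigma_bd m). lra.
      * apply (Csummable_le _ (fun n => if Nat.eq_dec n m then Cmod (b m) else 0)).
        -- intros n. destruct (Nat.eq_dec n m); [lra|rewrite Cmod_0; lra].
        -- eexists. apply is_series_delta.
      * apply Hoffs. assumption.
Qed.

End SparseInterpolation.

(** One [tau] serves every [f], the bound [N] on its data being prescribed: this lets a single
    sequence of translations defeat all of [dirichlet_Hinfty]. *)
Lemma exists_near_invariant_translation (x0 N T : R) : 0 < x0 -> 0 <= N -> 0 < T ->
  exists tau, T <= tau /\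
    forall (f : C -> C) (M K A : R), Hinfty f ->
      (forall z, 0 < Re z -> Cmod (f z) <= M) ->
      (forall eta h, (forall k, Cmod (nat_cpow_opp (S k) (0, h) - 1) <= eta * INR (S k)) ->
        forall z : C, A <= Re z -> Cmod (f (z + (0, h))%C - f z) <= K * eta) ->
      2 * M <= N -> K <= N -> A <= N ->
      forall y, Cmod (f (x0, y + tau)%R - f (x0, y)) <= / 4.
Proof.
  intros H0 Hn HT.
  destruct (smallness_propagation (x0) (N + 1 + x0) (N + 1) (/ 4))
    as [delta [Hdelta Hprop]]; try lra.
  destruct (exists_almost_period (delta / (N + 1)) T) as [tau [Htau Hap]].
  { apply Rdiv_lt_0_compat; lra. }
  { assumption. }
  exists tau. split; [assumption|]. intros f M K A [Hf _] HM HK HMn HKn HAn y.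
  assert (Hfd : forall z, 0 < Re z -> Cderivable f z).
  { intros z Hz. apply ex_derive_C_target, Hf, Hz. }
  pose (g := fun z => (f (1 * z + (0, tau)) - f z)%C).
  assert (Hre : forall z : C, Re (1 * z + (0, tau))%C = Re z).
  { intros [a b]. simpl. ring. }
  replace (f (x0, y + tau)%R - f (x0, y))%C with (g (x0, y)).
  2:{ unfold g. do 2 f_equal. unfold Cmult, Cplus; simpl. f_equal; ring. }
  apply Hprop; [| | |reflexivity].
  - intros z Hz. apply Cderivable_minus; [apply Cderivable_affine|]; apply Hfd; rewrite ?Hre; assumption.
  - intros z Hz. eapply Rle_trans; [apply Cmod_triangle|]. rewrite Cmod_opp.
    assert (G1 := HM z Hz). assert (G2 := HM (1 * z + (0, tau))%C ltac:(rewrite Hre; exact Hz)). lra.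
  - intros z Hz. unfold g. rewrite Cmult_1_l.
    eapply Rle_trans; [apply (HK _ _ Hap); lra|].
    replace delta with ((N + 1) * (delta / (N + 1))) at 2 by (field; lra).
    apply Rmult_le_compat_r; [|lra]. left; apply Rdiv_lt_0_compat; lra.
Qed.

Theorem mainTheorem6 (sigma : nat -> R)
  (sigma_pos : forall n : nat, 0 < sigma n)
  (sigma_lim : is_lim_seq sigma (Finite 0))
  (sigma_ratio : is_LimSup_seq (fun n : nat => sigma (S n) / sigma n) (Finite 1)) :
  exists s : nat -> C,
    (forall n : nat, right_half_plane (s n)) /\
    (forall n : nat, Re (s n) = sigma n) /\
    interpolating Hinfty s /\
    ~ interpolating dirichlet_Hinfty s.
Proof.
  assert (exists S0, forall n, 0 < sigma n <= S0) as [S0 HS0].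
  { destruct (filterlim_bounded (V:=R_NormedModule) sigma) as [M HM].
    { exists 0. exact sigma_lim. }
    exists M. intros n. split; [apply sigma_pos|]. eapply Rle_trans; [apply Rle_abs|apply HM]. }
  assert (HS : 0 < S0) by (generalize (HS0 O); lra).
  assert (Htp : forall n, 0 < 32 * S0 * 2 ^ n).
  { intros n. apply Rmult_lt_0_compat; [lra|apply pow_lt; lra]. }
  destruct (functional_choice _ (fun n => exists_near_invariant_translation (sigma n) (INR n)
    (32 * S0 * 2 ^ S n) (sigma_pos n) (pos_INR n) (Htp (S n)))) as [tau Htau].
  pose (t := fix t n := match n with O => 0 | S n => t n + tau n end).
  assert (Hmono : forall n k, t n <= t (n + k)%nat).
  { intros n k. induction k; [rewrite Nat.add_0_r; lra|].
    rewrite Nat.add_succ_r. simpl. generalize (Htau (n + k)%nat) (Htp (S (n + k))). lra. }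
  assert (Hgap : forall n m, (n < m)%nat -> 32 * S0 * 2 ^ m <= t m - t n).
  { intros n [|m] Hnm; [lia|]. simpl t.
    generalize (Hmono n (m - n)%nat) (proj1 (Htau m)). replace (n + (m - n))%nat with m by lia. lra. }
  assert (Hsep : forall n m, n <> m -> 32 * S0 * 2 ^ n <= Rabs (t n - t m)).
  { intros n m Hnm. destruct (Nat.lt_total n m) as [H|[H|H]]; [|contradiction|].
    - rewrite Rabs_minus_sym. eapply Rle_trans; [|apply Rle_abs].
      eapply Rle_trans; [|apply Hgap, H]. apply Rmult_le_compat_l; [lra|].
      apply Rle_pow; [lra|lia].
    - eapply Rle_trans; [|apply Rle_abs]. apply Hgap, H. }
  exists (fun n => (sigma n, t n)).
  split; [exact sigma_pos|]. split; [reflexivity|]. split.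
  { apply (sparse_interpolating sigma t S0 HS0 Hsep). }
  intros Hint.
  destruct (Hint (fun n => if Nat.even n then RtoC 1 else RtoC 0)) as [f [[Hf Hdir] Hval]].
  { exists 1. intros n. destruct (Nat.even n); rewrite ?Cmod_1, ?Cmod_0; lra. }
  assert (Hjump : forall n, 1 <= Cmod (f (sigma (S n), t (S n)) - f (sigma n, t n))).
  { intros n. rewrite (Hval n), (Hval (S n)), Nat.even_succ, <- Nat.negb_even.
    destruct (Nat.even n); simpl negb; cbv iota.
    - replace (0 - 1)%C with (- (1))%C by ring. rewrite Cmod_m1. lra.
    - replace (1 - 0)%C with (RtoC 1) by ring. rewrite Cmod_1. lra. }
  destruct (proj2 Hf) as [M HM].
  destruct (dirichlet_translation_bound f Hdir) as [K [A [_ [_ HKA]]]].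
  destruct rhp_modulus_of_continuity as [K' [HK' Hmod]].
  pose (e := Rmin (/ 4) (/ (16 * (K' * M ^ 2 + 1)))).
  assert (HKM : 0 <= K' * M ^ 2) by (apply Rmult_le_pos; [lra|apply pow2_ge_0]).
  assert (He : 0 < e).
  { apply Rmin_pos; [lra|]. apply Rinv_0_lt_compat. lra. }
  destruct (sigma_ratio (mkposreal e He)) as [Hfreq [N1 HN1]]. simpl in Hfreq, HN1.
  destruct (INR_unbounded (Rmax (2 * M) (Rmax K A))) as [N HN].
  destruct (Hfreq (Nat.max N N1)) as [n [Hn Hlow]].
  specialize (HN1 n ltac:(lia)).
  assert (HNn : INR N <= INR n) by (apply le_INR; lia).
  assert (B1 := Rmax_l (2 * M) (Rmax K A)). assert (B2 := Rmax_r (2 * M) (Rmax K A)).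
  assert (B3 := Rmax_l K A). assert (B4 := Rmax_r K A).
  assert (D1 : Cmod (f (sigma n, t n + tau n)%R - f (sigma n, t n)) <= / 4).
  { apply (proj2 (Htau n) f M K A Hf HM HKA); lra. }
  pose (rho := sigma (S n) / sigma n). fold rho in Hlow, HN1.
  assert (Hrho : Rabs (rho - 1) <= e) by (apply Rabs_le_between; lra).
  assert (He1 : e <= / 4) by apply Rmin_l.
  assert (He2 : e <= / (16 * (K' * M ^ 2 + 1))) by apply Rmin_r.
  assert (D2 : Cmod (f (sigma (S n), t (S n)) - f (sigma n, t (S n))) <= / 4).
  { replace (sigma (S n)) with (sigma n * rho).
    2:{ unfold rho. field. generalize (sigma_pos n). lra. }
    apply Rsqr_incr_0_var; [|lra]. rewrite !Rsqr_pow2.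
    eapply Rle_trans; [apply (Hmod f M); auto; [lra|]|].
    - intros z Hz. apply ex_derive_C_target, (proj1 Hf), Hz.
    - apply Rle_trans with (K' * M ^ 2 * / (16 * (K' * M ^ 2 + 1))).
      + apply Rmult_le_compat_l; [assumption|lra].
      + apply Rle_div_l; lra. }
  assert (D3 := Hjump n). change (t (S n)) with (t n + tau n) in *.
  generalize (Cmod_triangle (f (sigma (S n), t n + tau n)%R - f (sigma n, t n + tau n)%R)
                            (f (sigma n, t n + tau n)%R - f (sigma n, t n))).
  match goal with |- Cmod (?a - ?b + (?b - ?c)) <= _ -> _ =>
    replace (a - b + (b - c))%C with (a - c)%C by ring end.
  lra.
Qed.
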